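(* Let $v,k$ be integers with $k\ge 2$ and $v-k\ge 2$, let $d=\binom{v}{2}$, and let \[ f(v,k) = 2 \left( \frac{(k-1)(v-k-1)}{v-3} \right)^{d-v} \left( \frac{k(v-k)}{v-2} \right)^{d-1} \left( \frac{1}{v(v-1)} \right)^{d} .\] For a positive integer $t$ let $\Psi_{v,k,t}$ be the number of BIBD incidence matrices of dimensions $v\times t$ with exactly $k$ ones in each column. Then, for fixed $v$ and $k$, as $t\to\infty$ through positive integers $t$ satisfying $t\frac{k}{v}\in\mathbb Z$ and $t\frac{k(k-1)}{v(v-1)}\in\mathbb Z$, \[\Psi_{v,k, t} = [1 + o(1)] \frac{\binom{v}{k}^t}{\sqrt{(2 \pi t)^{d-1} f(v,k)}} . \]
   Context: A $v\times t$ matrix with entries in $\{0,1\}$ is called an incidence matrix of a balanced incomplete block design (BIBD incidence matrix) if there are positive integers $k$ and $\lambda$ such that every column contains exactly $k$ ones and every pair of distinct rows has inner product equal to $\lambda$ (the same $\lambda$ for all pairs). Matrices differing by a permutation of rows or columns are counted as distinct. *)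

(* Defs.v *)
From HB Require Import structures.
From mathcomp Require Export all_boot all_order all_algebra.
From mathcomp Require Export all_classical all_reals all_analysis.
Export Order.TTheory GRing.Theory Num.Theory.
Export numFieldNormedType.Exports.

Set Implicit Arguments.
Unset Strict Implicit.
Unset Printing Implicit Defensive.

(* A {0,1}-matrix is encoded as a boolean matrix; bool coerces to nat, with
   true read as 1. *)

Definition column_ones (v t : nat) (M : 'M[bool]_(v, t)) (j : 'I_t) : nat :=
  #|[pred i : 'I_v | M i j]|.

Definition row_inner (v t : nat) (M : 'M[bool]_(v, t)) (i i' : 'I_v) : nat :=
  (\sum_(j < t) M i j * M i' j)%N.

Definition is_BIBD_incidence (v t : nat) (M : 'M[bool]_(v, t)) : Prop :=
  exists k l : nat,
    [/\ (0 < k)%N, (0 < l)%N,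
        (forall j : 'I_t, column_ones M j = k) &
        (forall i i' : 'I_v, i <> i' -> row_inner M i i' = l)].

Definition Psi (v k t : nat) : nat :=
  #|[pred M : 'M[bool]_(v, t) |
      `[< is_BIBD_incidence M /\ forall j : 'I_t, column_ones M j = k >]]|.

Local Open Scope ring_scope.

Definition admissible (v k t : nat) : Prop :=
  [/\ (0 < t)%N,
      (t%:R * (k%:R / v%:R) : rat) \is a Num.int &
      (t%:R * ((k%:R * (k%:R - 1)) / (v%:R * (v%:R - 1))) : rat)
        \is a Num.int].

(* Only meaningful for v >= 4, where 'C(v, 2) - v and 'C(v, 2) - 1 are not
   truncated and no denominator vanishes. *)
Definition bibd_f (R : realType) (v k : nat) : R :=
  let d := 'C(v, 2) in
  2 * (((k%:R - 1) * (v%:R - k%:R - 1)) / (v%:R - 3)) ^+ (d - v)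
    * ((k%:R * (v%:R - k%:R)) / (v%:R - 2)) ^+ (d - 1)
    * (1 / (v%:R * (v%:R - 1))) ^+ d.

(* Main.v *)
(* A matrix with k ones in each column is a sequence of t blocks (k-subsets of the v
   points), so Psi / binom(v,k)^t is a point probability of a lattice walk with t uniform
   steps. Single out one point and one pair of the other points. The indicators of the
   other v - 1 points and of the pairs of these points except the singled-out pair are
   d - 1 coordinates of a block which determine all replication numbers and pair counts
   of the design, and the differences of the blocks generate the whole lattice Z^(d-1)
   in these coordinates. Hence the modulus of the characteristic function phi attains 1
   on the torus only at 0, and the local limit theorem gives
   Psi / binom(v,k)^t ~ 1 / sqrt((2 pi t)^(d-1) det Sigma), Sigma being the covariance
   matrix of one step. Subtracting (k-1)/(v-2) times the two point indicators from each pair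
   indicator makes the pairs uncorrelated with the points; the covariance of the residues
   is a multiple of a minor of a projection of the Johnson scheme, and
   det Sigma = f(v,k).

   The local limit theorem is proved by Fourier inversion on the finite grid of step
   2 pi / (2 t + 1): |phi^t - exp(-t Q / 2)| is at most C t^(-1/2) exp(-c t |theta|^2) on
   the grid, and the Gaussian sums over a grid of step h converge as h tends to 0, by
   induction on the dimension, completing one square at a time. *)
Require Import Defs.
From mathcomp Require Import ring lra zify.
From mathcomp.real_closed Require Import complex.

Set Implicit Arguments.
Unset Strict Implicit.
Unset Printing Implicit Defensive.

Local Open Scope classical_set_scope.
Local Open Scope ring_scope.

Import gauss_integral_proof.

(** * Gaussian sums over lattices *)

Section GaussPrimitive.
Variable R : realType.
Local Notation G := (@integral0_gauss R).

Lemma integrable_gauss_segment (a b : R) :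
  lebesgue_measure.-integrable `[a, b] (EFin \o @gauss_fun R).
Proof.
apply: continuous_compact_integrable; first exact: segment_compact.
by apply: continuous_subspaceT; exact: continuous_gauss_fun.
Qed.

Lemma ler_gauss_fun (x y : R) : 0 <= x -> x <= y -> gauss_fun y <= gauss_fun x.
Proof. by move=> x0 xy; rewrite ler_expR lerN2 ler_sqr ?nnegrE //; lra. Qed.

Lemma integral0_gauss0 : G 0 = 0.
Proof. by rewrite /integral0_gauss set_itv1 Rintegral_set1. Qed.

(** The integrand decreases on the half-line, so on the interval it lies between its two endpoint
    values. *)
Lemma integral0_gaussB (x y : R) : 0 <= x -> x <= y ->
  (y - x) * gauss_fun y <= G y - G x <= (y - x) * gauss_fun x.
Proof.
move=> x0 xy.
have cstI (c : R) : \int[lebesgue_measure]_(t in `]x, y]) c = (y - x) * c.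
  rewrite Rintegral_cst// mulrC; congr (_ * _).
  rewrite /= lebesgue_measure_itv/= lte_fin.
  by case: ltgtP xy => //= -> _; rewrite subrr.
have gI : lebesgue_measure.-integrable `]x, y] (EFin \o @gauss_fun R).
  apply: (integrableS _ _ _ (integrable_gauss_segment x y)) => //.
  by apply: subset_itvr; rewrite bnd_simp.
have cI (c : R) : lebesgue_measure.-integrable `]x, y] (EFin \o (fun=> c)).
  have cI : lebesgue_measure.-integrable `[x, y] (EFin \o (fun=> c)).
    apply: continuous_compact_integrable; first exact: segment_compact.
    by apply: continuous_subspaceT => z; exact: cvg_cst.
  apply: (integrableS _ _ _ cI) => //.
  by apply: subset_itvr; rewrite bnd_simp.
rewrite /integral0_gauss Rintegral_itvB ?bnd_simp//; last first.
  exact: integrable_gauss_segment.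
rewrite -!cstI; apply/andP; split; apply: le_Rintegral => //= t.
  by rewrite in_itv/= => /andP[xt ty]; apply: ler_gauss_fun => //; lra.
by rewrite in_itv/= => /andP[xt ty]; apply: ler_gauss_fun => //; lra.
Qed.

Lemma cvg_integral0_gauss : G x @[x --> +oo] --> Num.sqrt pi / 2.
Proof.
have -> : Num.sqrt pi / 2 = Num.sqrt (pi / 4) :> R.
  rewrite sqrtrM ?pi_ge0// sqrtrV// (_ : 4 = 2 ^+ 2); last by rewrite expr2 -natrM.
  by rewrite sqrtr_sqr ger0_norm.
have -> : G = fun x => Num.sqrt (G x ^+ 2).
  by apply/funext => r; rewrite sqrtr_sqr ger0_norm// integral0_gauss_ge0.
by apply: continuous_cvg; [exact: sqrt_continuous|exact: cvg_integral0_gauss_sqr].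
Qed.

Lemma integral0_gauss_nd (x y : R) : 0 <= x -> x <= y -> G x <= G y.
Proof.
move=> x0 xy; have /andP[+ _] := integral0_gaussB x0 xy.
have : 0 <= (y - x) * gauss_fun y by rewrite mulr_ge0 ?gauss_fun_ge0 //; lra.
lra.
Qed.

Lemma integral0_gauss_le (x : R) : 0 <= x -> G x <= Num.sqrt pi / 2.
Proof.
move=> x0; apply: (cvgr_to_ge cvg_integral0_gauss).
near=> y; apply: integral0_gauss_nd => //; near: y; exact: nbhs_pinfty_ge.
Unshelve. all: by end_near. Qed.

(** The Riemann sums of a decreasing function exceed its integral by at most the first rectangle,
    here of area at most [h]. Starting at [c] instead of 0 loses [G c <= h], whence the lower
    bound. *)
Lemma gauss_halfline_sum (h c : R) : 0 < h -> 0 <= c <= h ->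
  ((Num.sqrt pi / 2 - h)%:E <=
    \esum_(n in [set: nat]) (h * gauss_fun (h * n%:R + c))%:E <=
   (Num.sqrt pi / 2 + h)%:E)%E.
Proof.
move=> h0 /andP[c0 ch].
have pos n : 0 <= h * gauss_fun (h * n%:R + c).
  by rewrite mulr_ge0 ?gauss_fun_ge0// ltW.
have x0 n : 0 <= h * n%:R + c by rewrite addr_ge0// mulr_ge0// ltW.
have xS n : h * n.+1%:R + c = h * n%:R + c + h by rewrite -natr1; ring.
have lower n : G (h * n%:R + c) - G c <= \sum_(0 <= i < n) (h * gauss_fun (h * i%:R + c)).
  elim: n => [|n IH]; first by rewrite mulr0 add0r subrr big_geq.
  rewrite big_nat_recr//= xS.
  have := @integral0_gaussB _ (h * n%:R + c + h) (x0 n).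
  rewrite lerDl (ltW h0) => /(_ isT) /andP[_]; lra.
have upper n : \sum_(0 <= i < n.+1) (h * gauss_fun (h * i%:R + c)) <= h + G (h * n%:R + c) - G c.
  elim: n => [|n IH].
    rewrite big_nat1 mulr0 add0r addrK ler_piMr ?gauss_fun_le1//; exact: ltW.
  rewrite big_nat_recr//= xS.
  have := @integral0_gaussB _ (h * n%:R + c + h) (x0 n).
  rewrite lerDl (ltW h0) => /(_ isT) /andP[+ _]; lra.
rewrite -nneseries_esumT; last by move=> n; rewrite lee_fin.
have Gc : G c <= h.
  have /andP[_] := integral0_gaussB (lexx 0) c0.
  rewrite integral0_gauss0; have := @gauss_fun_le1 R 0; nra.
apply/andP; split.
  set S := (X in (_ <= X)%E).
  have S0 n : ((G (h * n%:R + c) - G c)%:E <= S)%E.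
    apply: (le_trans _ (nneseries_lim_ge n _)); last by move=> *; rewrite lee_fin.
    by rewrite sumEFin lee_fin.
  case: S S0 => [r S0| |S0]; [|by rewrite leey|by have := S0 0%N].
  rewrite lee_fin lerBlDr; apply: (cvgr_to_le cvg_integral0_gauss).
  near=> x.
  have [n xn] : exists n : nat, x / h < n%:R.
    by exists (Num.truncn (x / h)).+1; exact: truncnS_gt.
  have hx : x <= h * n%:R + c by move: xn; rewrite ltr_pdivrMr// mulrC; lra.
  have := S0 n; rewrite lee_fin; suff : G x <= G (h * n%:R + c) by lra.
  by apply: integral0_gauss_nd.
apply: lime_le; first by apply: is_cvg_nneseries => n _ _; rewrite lee_fin.
near=> n; rewrite sumEFin lee_fin.
have n1 : (0 < n)%N by near: n; exact: nbhs_infty_gt.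
rewrite -(prednK n1); apply: (le_trans (upper _)).
have := integral0_gauss_le (x0 n.-1); have := integral0_gauss_ge0 c; lra.
Unshelve. all: by end_near. Qed.

End GaussPrimitive.

Section GaussSum.
Variable R : realType.

Lemma esumZl (T : choiceType) (I : set T) (f : T -> \bar R) (c : R) : 0 <= c ->
  (forall i, 0 <= f i)%E ->
  (\esum_(i in I) (c%:E * f i) = c%:E * \esum_(i in I) f i)%E.
Proof.
move=> c0 f0; rewrite /esum -ereal_supZl//; last first.
  by apply/set0P; exists (\sum_(x \in set0) f x)%E, set0 => //; exact: fsets_set0.
congr ereal_sup; rewrite image_comp; apply: eq_imagel => A [finA _] /=.
by rewrite ge0_mule_fsumr.
Qed.

Lemma esum_int (f : int -> \bar R) : (forall z, 0 <= f z)%E ->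
  (\esum_(z in [set: int]) f z =
   \esum_(n in [set: nat]) f (Posz n) + \esum_(n in [set: nat]) f (Negz n))%E.
Proof.
move=> f0; rewrite (esumID (range Posz))//; congr (_ + _)%E; rewrite setTI.
  by rewrite esum_image// => m n _ _ [].
rewrite (_ : ~` _ = range Negz); first by rewrite esum_image// => m n _ _ [].
apply/seteqP; split => [[n|n] //= h|_ [n _ <-] [m _]//]; last by exists n.
by exfalso; apply: h; exists n.
Qed.

(** Moving [c] by a multiple of [h] only reindexes the sum, so [c] may be taken between 0 and [h].
    The negative indices, reflected, then form a half-line sum with offset [h - c], and each half
    errs by at most [h]. The uniformity in [c] is what completing the square requires. *)
Lemma gauss_line_sum (h c : R) : 0 < h ->
  ((Num.sqrt pi - 2 * h)%:E <=
    \esum_(z in [set: int]) (h * gauss_fun (h * z%:~R + c))%:E <=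
   (Num.sqrt pi + 2 * h)%:E)%E.
Proof.
move=> h0; set m := Num.floor (c / h); set c0 := c - h * m%:~R.
have c0h : 0 <= c0 <= h.
  have := floor_le (c / h); have := floorD1_gt (c / h); rewrite -/m.
  rewrite intrD ler_pdivlMr// ltr_pdivrMr// /c0; lra.
rewrite (@reindex_esum _ _ _ setT setT (fun z => z - m)); last first.
  split => //; first by move=> x y _ _ /addIr.
  by move=> y _ /=; exists (y + m) => //; rewrite addrK.
rewrite (eq_esum (b := fun z => (h * gauss_fun (h * z%:~R + c0))%:E)); last first.
  by move=> z _; rewrite /c0 intrB; congr (_ * gauss_fun _)%:E; ring.
rewrite esum_int; last by move=> z; rewrite lee_fin mulr_ge0 ?gauss_fun_ge0// ltW.
have /andP[l1 u1] := gauss_halfline_sum h0 c0h.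
have /andP[l2 u2] := @gauss_halfline_sum _ h (h - c0) h0 ltac:(lra).
rewrite (eq_esum (I := [set: nat]) (a := fun n => (h * gauss_fun (h * (Negz n)%:~R + c0))%:E)
    (b := fun n => (h * gauss_fun (h * n%:R + (h - c0)))%:E)); last first.
  move=> n _; rewrite NegzE /gauss_fun; congr (_ * expR (- _))%:E.
  by rewrite -[LHS]sqrrN mulrNz -pmulrn -natr1; congr (_ ^+ 2); ring.
apply/andP; split.
  by apply: le_trans (leeD l1 l2); rewrite -EFinD lee_fin; lra.
by apply: (le_trans (leeD u1 u2)); rewrite -EFinD lee_fin; lra.
Qed.

(** Scaling by [s = sqrt (a / 2)] changes the mesh to [s * h] and the sum by the factor [s^-1], so
    the error remains [2 * h]. *)
Lemma gauss_line_sum_scaled (a h c : R) : 0 < a -> 0 < h ->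
  ((Num.sqrt (2 * pi / a) - 2 * h)%:E <=
    \esum_(z in [set: int]) (h * expR (- (a * (h * z%:~R + c) ^+ 2) / 2))%:E <=
   (Num.sqrt (2 * pi / a) + 2 * h)%:E)%E.
Proof.
move=> a0 h0; set s := Num.sqrt (a / 2).
have s0 : 0 < s by rewrite sqrtr_gt0 divr_gt0.
have s2 : s ^+ 2 = a / 2 by rewrite sqr_sqrtr// divr_ge0// ltW.
have -> : Num.sqrt (2 * pi / a) = s^-1 * Num.sqrt pi.
  by rewrite -sqrtrV ?divr_ge0// ?ltW// -sqrtrM ?invr_ge0 ?divr_ge0// ?ltW// invf_div; congr Num.sqrt; ring.
have /andP[l u] := @gauss_line_sum (s * h) (s * c) (mulr_gt0 s0 h0).
rewrite (eq_esum (b := fun z => ((s^-1)%:E * (s * h * gauss_fun (s * h * z%:~R + s * c))%:E)%E)); last first.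
  move=> z _; rewrite -EFinM; congr _%:E.
  rewrite !mulrA mulVf ?gt_eqF// mul1r; congr (_ * expR _).
  by rewrite (_ : s * h * z%:~R + s * c = s * (h * z%:~R + c)) ?exprMn ?s2; field.
rewrite esumZl ?invr_ge0 ?(ltW s0)//; last first.
  by move=> z; rewrite lee_fin mulr_ge0 ?gauss_fun_ge0// mulr_ge0 ?ltW.
have eqs (x : R) : s^-1 * Num.sqrt pi + x * h = s^-1 * (Num.sqrt pi + x * (s * h)).
  by field; rewrite gt_eqF.
rewrite -mulNr !eqs !(EFinM s^-1) mulNr; apply/andP.
by split; apply: lee_wpmul2l => //; rewrite lee_fin invr_ge0 ltW.
Qed.

(** * Gaussian sums of positive definite quadratic forms *)

Definition quad n (A : 'M[R]_n) (x : 'rV[R]_n) : R := (x *m A *m x^T) 0 0.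

Definition posdef n (A : 'M[R]_n) := A^T = A /\ forall x, x != 0 -> 0 < quad A x.

(** The Riemann sum of mesh [h] for the Gaussian integral over R^n. It is an extended real because
    its finiteness is only obtained together with its limit. *)
Definition gauss_sum n (A : 'M[R]_n) (h : R) : \bar R :=
  \esum_(z in [set: 'rV[int]_n])
    (h ^+ n * expR (- quad A (h *: map_mx intr z) / 2))%:E.

Lemma gauss_sum_ge0 n (A : 'M[R]_n) h : 0 <= h -> (0 <= gauss_sum A h)%E.
Proof. by move=> h0; apply: esum_ge0 => z _; rewrite lee_fin mulr_ge0 ?exprn_ge0 ?expR_ge0. Qed.

Definition schur n (A : 'M[R]_(1 + n)) : 'M[R]_n :=
  drsubmx A - (A 0 0)^-1 *: ((ursubmx A)^T *m ursubmx A).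

Lemma mx11_block n (A : 'M[R]_(1 + n)) : A^T = A ->
  A = block_mx (A 0 0)%:M (ursubmx A) (ursubmx A)^T (drsubmx A).
Proof.
move=> sA; rewrite -{1}(submxK A); congr block_mx.
  by rewrite [LHS]mx11_scalar !mxE !lshift0.
by rewrite -{1}sA -trmx_ursub.
Qed.

(** Completing the square in the first coordinate. *)
Lemma quad_schur n (A : 'M[R]_(1 + n)) (x : R) (y : 'rV[R]_n) :
  A^T = A -> A 0 0 != 0 ->
  quad A (row_mx x%:M y) =
    A 0 0 * (x + (y *m (ursubmx A)^T) 0 0 / A 0 0) ^+ 2 + quad (schur A) y.
Proof.
move=> sA a0; rewrite /quad {1}(mx11_block sA).
set a := A 0 0; set b := ursubmx A; set D := drsubmx A.
rewrite mul_row_block tr_row_mx mul_row_col /schur -/a -/b -/D.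
rewrite mulmxBr mulmxBl -scalemxAr -scalemxAl.
have e1 : b *m y^T = ((y *m b^T) 0 0)%:M.
  by rewrite -[RHS]tr_scalar_mx -mx11_scalar trmx_mul trmxK.
have -> : y *m (b^T *m b) *m y^T = (((y *m b^T) 0 0) ^+ 2)%:M.
  by rewrite mulmxA -mulmxA e1 {1}[y *m b^T]mx11_scalar -scalar_mxM expr2.
rewrite !mulmxDl [x%:M *m b]mul_scalar_mx -scalemxAl e1 tr_scalar_mx.
rewrite [y *m b^T]mx11_scalar -!scalar_mxM {e1}.
move: (y *m D *m y^T) ((y *m b^T) 0 0) => Y w.
by rewrite !mxE /= !mulr1n; field.
Qed.

Lemma det_schur n (A : 'M[R]_(1 + n)) : A^T = A -> A 0 0 != 0 ->
  \det A = A 0 0 * \det (schur A).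
Proof.
move=> sA a0; set a := A 0 0; set b := ursubmx A.
have AE : A = block_mx 1%:M 0 (a^-1 *: b^T) 1%:M *m block_mx a%:M b 0 (schur A).
  rewrite mulmx_block !mul1mx !mul0mx ?mulmx0 !addr0 -scalemxAl mul_mx_scalar scalerA mulVf// scale1r.
  by rewrite -scalemxAl /schur addrC subrK -mx11_block.
by rewrite {1}AE det_mulmx det_lblock det_ublock !det1 !mul1r det_scalar1.
Qed.

Lemma posdef_schur n (A : 'M[R]_(1 + n)) : posdef A -> 0 < A 0 0 /\ posdef (schur A).
Proof.
move=> [sA pA].
have a0 : 0 < A 0 0.
  have := pA (row_mx 1%:M 0); rewrite row_mx_eq0 oner_eq0 /= => /(_ isT).
  rewrite /quad {1}(mx11_block sA) mul_row_block tr_row_mx mul_row_col !mul0mx trmx0 mulmx0 !addr0.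
  by rewrite tr_scalar_mx mulmx1 mul1mx mxE eqxx mulr1n.
split=> //; split.
  by rewrite /schur linearB linearZ /= trmx_mul trmxK trmx_drsub sA.
move=> y y0.
(* This first coordinate makes the completed square vanish. *)
set x := - ((y *m (ursubmx A)^T) 0 0 / A 0 0).
have := pA (row_mx x%:M y); rewrite row_mx_eq0 negb_and y0 orbT => /(_ isT).
by rewrite quad_schur ?gt_eqF// /x addNr expr0n mulr0 add0r.
Qed.

Lemma gauss_sum_schur n (A : 'M[R]_(1 + n)) (h : R) : posdef A -> 0 < h ->
  gauss_sum A h = (\esum_(y in [set: 'rV[int]_n])
    ((h ^+ n * expR (- quad (schur A) (h *: map_mx intr y) / 2))%:E *
     \esum_(z in [set: int])
       (h * expR (- (A 0 0 * (h * z%:~R +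
          ((h *: map_mx intr y) *m (ursubmx A)^T) 0 0 / A 0 0) ^+ 2) / 2))%:E))%E.
Proof.
move=> pA h0; have [a0 _] := posdef_schur pA.
pose f (y : 'rV[int]_n) := h ^+ n * expR (- quad (schur A) (h *: map_mx intr y) / 2).
pose g (y : 'rV[int]_n) (z : int) := h * expR (- (A 0 0 * (h * z%:~R +
          ((h *: map_mx intr y) *m (ursubmx A)^T) 0 0 / A 0 0) ^+ 2) / 2).
have f0 y : 0 <= f y by rewrite mulr_ge0 ?expR_ge0// exprn_ge0// ltW.
have g0 y z : 0 <= g y z by rewrite mulr_ge0 ?expR_ge0// ltW.
rewrite (eq_esum (b := fun y => \esum_(z in [set: int]) ((f y)%:E * (g y z)%:E)%E)); last first.
  by move=> y _; rewrite esumZl// => z; rewrite lee_fin.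
rewrite esum_esum; last by move=> *; rewrite -EFinM lee_fin mulr_ge0.
rewrite /gauss_sum (@reindex_esum _ _ _ ([set: 'rV[int]_n] `*`` (fun=> [set: int])) setT
    (fun k => row_mx k.2%:M k.1 : 'rV[int]_(1 + n))); last first.
  split => //.
    move=> [y x] [y' x'] _ _ /eq_row_mx[/matrixP/(_ 0 0)]; rewrite !mxE/= !mulr1n.
    by move=> -> ->.
  move=> z _ /=; exists (rsubmx z, lsubmx z 0 0) => //=.
  by rewrite -mx11_scalar hsubmxK.
apply: eq_esum => -[y z] _ /=; rewrite -EFinM; congr _%:E.
rewrite map_row_mx scale_row_mx map_scalar_mx scale_scalar_mx quad_schur ?gt_eqF//; last by case: pA.
by rewrite opprD mulrDl expRD (exprS h n) mulrACA mulrC.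
Qed.

(** The inner sum over the first coordinate is a shifted one-dimensional Gaussian sum, whose bounds
    do not depend on the shift. The condition on [h] keeps the lower factor nonnegative. *)
Lemma gauss_sum_bounds n (A : 'M[R]_(1 + n)) (h : R) : posdef A -> 0 < h ->
  2 * h <= Num.sqrt (2 * pi / A 0 0) ->
  ((Num.sqrt (2 * pi / A 0 0) - 2 * h)%:E * gauss_sum (schur A) h <= gauss_sum A h <=
   (Num.sqrt (2 * pi / A 0 0) + 2 * h)%:E * gauss_sum (schur A) h)%E.
Proof.
move=> pA h0 hs; have [a0 _] := posdef_schur pA.
have p0 y : (0 <= (h ^+ n * expR (- quad (schur A) (h *: map_mx intr y) / 2))%:E)%E.
  by rewrite lee_fin mulr_ge0 ?exprn_ge0 ?expR_ge0 ?ltW.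
rewrite gauss_sum_schur// -!esumZl//; [|lra|lra].
have b (y : 'rV[int]_n) := gauss_line_sum_scaled
  (((h *: map_mx intr y) *m (ursubmx A)^T) 0 0 / A 0 0) a0 h0.
apply/andP; split; apply: le_esum => y _; case/andP: (b y) => l u.
  by rewrite muleC; apply: lee_wpmul2l.
by rewrite [X in (_ <= X)%E]muleC; apply: lee_wpmul2l.
Qed.

(** By induction, each coordinate contributes the factor [sqrt (2 * pi / A 0 0)] up to [2 * h], and
    the pivots multiply to the determinant. Finiteness is carried along because [fine] sends an
    infinite sum to 0. *)
Lemma gauss_sum_cvg n (A : 'M[R]_n) : posdef A ->
  [/\ 0 < \det A, \forall h \near 0^'+, gauss_sum A h \is a fin_num &
     fine (gauss_sum A h) @[h --> 0^'+] --> Num.sqrt ((2 * pi) ^+ n / \det A)].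
Proof.
elim: n A => [|n IH] A pA.
  have gE h : gauss_sum A h = 1%E.
    rewrite /gauss_sum (_ : setT = [set 0]); last first.
      by apply/seteqP; split => // z _ /=; apply/matrixP => i [].
    rewrite esum_set1; rewrite /quad map_mx0 scaler0 mul0mx mul0mx mxE oppr0 mul0r expR0 mulr1 expr0//.
  split; first by rewrite det_mx00.
    by near=> h; rewrite gE.
  rewrite det_mx00 expr0 divr1 sqrtr1.
  by under eq_cvg do rewrite gE; exact: cvg_cst.
have [a0 pS] := posdef_schur (n := n) pA.
have [dS finS cvS] := IH _ pS.
set s := Num.sqrt (2 * pi / A 0 0).
have s0 : 0 < s by rewrite sqrtr_gt0 divr_gt0// mulr_gt0// pi_gt0.
have small : \forall h \near 0^'+, [/\ 0 < h, 2 * h <= s & gauss_sum (schur A) h \is a fin_num].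
  near=> h; split.
  - by near: h; exact: nbhs_right_gt.
  - rewrite mulrC -ler_pdivlMr//; near: h; apply: nbhs_right_le; exact: divr_gt0.
  - by near: h.
have finA : \forall h \near 0^'+, gauss_sum A h \is a fin_num.
  near=> h; have [h0 hs fS] : [/\ 0 < h, 2 * h <= s & gauss_sum (schur A) h \is a fin_num] by near: h.
  have /andP[_ u] := gauss_sum_bounds pA h0 hs.
  rewrite ge0_fin_numE ?gauss_sum_ge0 ?ltW//; apply: (le_lt_trans u).
  by rewrite ltey_eq fin_numM.
split => //.
  by rewrite (det_schur (n := n)) ?gt_eqF ?mulr_gt0//; case: pA.
have -> : Num.sqrt ((2 * pi) ^+ n.+1 / \det A) = s * Num.sqrt ((2 * pi) ^+ n / \det (schur A)).
  rewrite -sqrtrM ?divr_ge0 ?mulr_ge0 ?pi_ge0 ?ltW// (det_schur (n := n)) ?gt_eqF//; last by case: pA.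
  by congr Num.sqrt; rewrite exprS; field; rewrite !gt_eqF.
apply: (@squeeze_cvgr _ _ _ _ (fun h => (s - 2 * h) * fine (gauss_sum (schur A) h))
                            (fun h => (s + 2 * h) * fine (gauss_sum (schur A) h))).
- near=> h; have [h0 hs fS] : [/\ 0 < h, 2 * h <= s & gauss_sum (schur A) h \is a fin_num] by near: h.
  have fA : gauss_sum A h \is a fin_num by near: h.
  by rewrite -!lee_fin !EFinM !fineK// gauss_sum_bounds.
- apply: cvgM => //; rewrite -[X in _ --> X]subr0; apply: cvgB; first exact: cvg_cst.
  rewrite -[X in _ --> X](mulr0 2); apply: cvgM; first exact: cvg_cst.
  by apply: cvg_at_right_filter; exact: cvg_id.
- apply: cvgM => //; rewrite -[X in _ --> X]addr0; apply: cvgD; first exact: cvg_cst.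
  rewrite -[X in _ --> X](mulr0 2); apply: cvgM; first exact: cvg_cst.
  by apply: cvg_at_right_filter; exact: cvg_id.
Unshelve. all: by end_near. Qed.

End GaussSum.

(** * Elementary bounds for sine, cosine and the exponential *)

Section TrigBounds.
Variable R : realType.
Implicit Types x y : R.

Lemma sin_le_id x : 0 <= x -> sin x <= x.
Proof.
rewrite le_eqVlt => /predU1P[<-|x0]; first by rewrite sin0.
have [c _ ] := @MVT R sin cos 0 x x0 (fun c _ => is_derive_sin c)
  (continuous_subspaceT (@continuous_sin R)).
rewrite sin0 !subr0 => ->; have := cos_le1 c; nra.
Qed.

Lemma ler_norm_sin x : `|sin x| <= `|x|.
Proof.
wlog x0 : x / 0 <= x.
  move=> H; have [/H//|/ltW x0] := leP 0 x.
  by rewrite -normrN -sinN -[`|x|]normrN H// oppr_ge0.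
rewrite (ger0_norm x0) ler_norml sin_le_id// andbT.
have [x1|x1] := leP x 1; last by have := sin_geN1 x; lra.
have : 0 <= sin x by apply: sin_ge0_pi; have := pi_ge2 R; lra.
lra.
Qed.

Lemma cosE_half x : cos x = 1 - 2 * sin (x / 2) ^+ 2.
Proof.
have {1}-> : x = (x / 2) *+ 2 by rewrite mulr2n; field.
by rewrite cos_mulr2n cos2sin2; ring.
Qed.

Lemma cos_ge_quad x : 1 - x ^+ 2 / 2 <= cos x.
Proof.
rewrite cosE_half; have : sin (x / 2) ^+ 2 <= (x / 2) ^+ 2.
  by rewrite -[leLHS]real_normK ?num_real// -[leRHS]real_normK ?num_real// ler_sqr ?nnegrE// ler_norm_sin.
lra.
Qed.

Lemma sin_sub_id_le x : `|sin x - x| <= `|x| ^+ 3 / 2.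
Proof.
wlog x0 : x / 0 <= x.
  move=> H; have [/H//|/ltW x0] := leP 0 x.
  by have := H (- x); rewrite oppr_ge0 sinN -opprD !normrN => ->.
rewrite (ger0_norm x0) ler0_norm ?subr_le0 ?sin_le_id//.
move: x0; rewrite le_eqVlt => /predU1P[<-|x0]; first by rewrite sin0 expr0n/=; lra.
have [c] := @MVT R sin cos 0 x x0 (fun c _ => is_derive_sin c)
  (continuous_subspaceT (@continuous_sin R)).
rewrite in_itv/= sin0 !subr0 => /andP[c0 cx] ->; have := cos_ge_quad c.
have : c ^+ 2 <= x ^+ 2 by rewrite ler_sqr ?nnegrE; lra.
rewrite exprSr => ? ?; nra.
Qed.

(** The half-angle formula gives a difference of two squares. Up to [|x| = 2] the cubic bound on
    [x / 2 - sin (x / 2)] suffices; beyond, both factors are at most [|x|]. *)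
Lemma cos_taylor_le x : `|cos x - 1 + x ^+ 2 / 2| <= `|x| ^+ 3.
Proof.
have -> : cos x - 1 + x ^+ 2 / 2 = 2 * ((x / 2 - sin (x / 2)) * (x / 2 + sin (x / 2))).
  by rewrite cosE_half; field.
rewrite normrM normrM ger0_norm//.
have h1 := sin_sub_id_le (x / 2); rewrite distrC in h1.
have h2 := ler_norm_sin (x / 2).
have h3 := ler_normD (x / 2) (sin (x / 2)).
have h4 := ler_normB (x / 2) (sin (x / 2)).
have xe : `|x / 2| = `|x| / 2 by rewrite normrM (ger0_norm (x := 2^-1))// invr_ge0.
move: h1 h2 h3 h4; rewrite xe; set a := `|x|; set p := `|x / 2 - _|; set q := `|x / 2 + _|; set s := `|sin _|.
move=> h1 h2 h3 h4.
have a0 : 0 <= a := normr_ge0 _.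
have p0 : 0 <= p := normr_ge0 _.
have pq : p * q <= p * a by apply: ler_wpM2l => //; lra.
have [a2|a2] := leP a 2.
  have : p * a <= (a / 2) ^+ 3 / 2 * a by apply: ler_wpM2r.
  have e3 : 0 <= a ^+ 3 by rewrite exprn_ge0.
  have : a ^+ 3 * a <= a ^+ 3 * 2 by apply: ler_wpM2l.
  rewrite !exprMn; lra.
have : p * a <= a * a by apply: ler_wpM2r => //; lra.
have : a * a * 2 <= a * a * a by apply: ler_wpM2l; [exact: mulr_ge0|lra].
rewrite exprS expr2; lra.
Qed.

Lemma ler_norm_sinD x y : `|sin (x + y)| <= `|sin x| + `|sin y|.
Proof.
rewrite sinD; apply: (le_trans (ler_normD _ _)); rewrite !normrM.
by apply: lerD; [rewrite ler_piMr ?cos_max|rewrite ler_piMl ?cos_max].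
Qed.

Lemma ler_norm_sin_mulz (m : int) x : `|sin (m%:~R * x)| <= `|m|%:~R * `|sin x|.
Proof.
have nat_case (k : nat) : `|sin (k%:R * x)| <= k%:R * `|sin x|.
  elim: k => [|k IH]; first by rewrite !mul0r sin0 normr0.
  rewrite -natr1 !mulrDl !mul1r; apply: (le_trans (ler_norm_sinD _ _)); exact: lerD.
case: m => k; first exact: nat_case.
rewrite NegzE normrN mulrNz mulNr sinN normrN; exact: nat_case.
Qed.

(** The absolute value of the sine is subadditive. Angles close to multiples of pi thus have integer
    combinations close to multiples of pi. *)
Lemma ler_norm_sin_sum (I : finType) (c : I -> int) (y : I -> R) :
  `|sin (\sum_i (c i)%:~R * y i)| <= \sum_i `|c i|%:~R * `|sin (y i)|.
Proof.
elim/big_ind2: _ => [|x a z b xa zb|i _].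
- by rewrite sin0 normr0.
- by apply: (le_trans (ler_norm_sinD _ _)); exact: lerD.
- exact: ler_norm_sin_mulz.
Qed.

(* Compare the mean value theorem on [0, x / 2] and on [x / 2, pi / 2]: [cos] decreases. *)
Lemma jordan_sin x : `|x| <= pi -> `|x| / pi <= `|sin (x / 2)|.
Proof.
wlog x0 : x / 0 <= x.
  move=> H; have [/H//|/ltW x0] := leP 0 x.
  by have := H (- x); rewrite oppr_ge0 mulNr sinN !normrN => /(_ x0).
rewrite ger0_norm// => xpi.
have pi0 := pi_gt0 R.
rewrite ger0_norm; last by apply: sin_ge0_pi; lra.
move: x0; rewrite le_eqVlt => /predU1P[<-|x0]; first by rewrite !mul0r sin0.
move: xpi; rewrite le_eqVlt => /predU1P[->|xpi].
  by rewrite divff ?gt_eqF// sin_pihalf.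
have y0 : 0 < x / 2 by lra.
have ypi : x / 2 < pi / 2 by lra.
have [c] := @MVT R sin cos 0 (x / 2) y0 (fun c _ => is_derive_sin c)
  (continuous_subspaceT (@continuous_sin R)).
rewrite in_itv/= sin0 !subr0 => /andP[c0 cx] sc.
have [d] := @MVT R sin cos (x / 2) (pi / 2) ypi (fun c _ => is_derive_sin c)
  (continuous_subspaceT (@continuous_sin R)).
rewrite in_itv/= sin_pihalf => /andP[dx dpi] sd.
have dc : cos d < cos c.
  rewrite ltr_cos ?in_itv/=; lra.
rewrite ler_pdivrMr// sc.
have -> : cos c * (x / 2) * pi = x * (cos c * (x / 2) + cos c * (pi / 2 - x / 2)) by field.
rewrite ler_peMr ?(ltW x0)//.
have : (cos d) * (pi / 2 - x / 2) <= cos c * (pi / 2 - x / 2).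
  by apply: ler_wpM2r; lra.
lra.
Qed.

Lemma expR_taylor_le y : 0 <= y -> `|expR (- y) - 1 + y| <= y ^+ 2.
Proof.
move=> y0.
have l := expR_ge1Dx (- y).
have [y1|y1] := leP y 1; last first.
  have := expR_gt0 (- y); have : expR (- y) <= 1 by rewrite -expR0 ler_expR; lra.
  by move=> ? ?; rewrite ger0_norm; nra.
have u : expR (- y) * (1 + y) <= 1.
  rewrite -[leRHS](expRxMexpNx_1 y) mulrC; apply: ler_wpM2r; [exact: expR_ge0|exact: expR_ge1Dx].
rewrite ger0_norm; last lra.
have := expR_gt0 (- y); nra.
Qed.

(** For [y > 1] the cube is below the fourth power, which is absorbed by the square of
    [H = expR (c * y ^+ 2 / 2)], since [H >= c * y ^+ 2 / 2]. *)
Lemma cube_expR_le (c y : R) : 0 < c -> 0 <= y ->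
  y ^+ 3 * expR (- (c * y ^+ 2)) <= 1 + 4 / c ^+ 2.
Proof.
move=> c0 y0; set E := expR _.
have E0 : 0 < E := expR_gt0 _.
have E1 : E <= 1 by rewrite -expR0 ler_expR oppr_le0 mulr_ge0 ?sqr_ge0 ?ltW.
have [y1|y1] := leP y 1.
  have : y ^+ 3 <= 1 by rewrite exprn_ile1.
  have : 0 <= 4 / c ^+ 2 by rewrite divr_ge0// sqr_ge0.
  have : 0 <= y ^+ 3 by rewrite exprn_ge0.
  nra.
have y34 : y ^+ 3 <= (y ^+ 2) ^+ 2 by rewrite -exprM ler_weXn2l// ltW.
pose H := expR (c * y ^+ 2 / 2).
have EH : E * H ^+ 2 = 1.
  by rewrite expr2 /E /H -!expRD -[RHS]expR0; congr expR; field.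
have hH : c * y ^+ 2 / 2 <= H by have := expR_ge1Dx (c * y ^+ 2 / 2); rewrite -/H; lra.
have cy : 0 <= c * y ^+ 2 / 2 by rewrite divr_ge0// mulr_ge0 ?sqr_ge0 ?ltW.
have H2 : (c * y ^+ 2 / 2) ^+ 2 <= H ^+ 2 by rewrite ler_sqr ?nnegrE//; lra.
have -> : 1 + 4 / c ^+ 2 = 1 + 4 / c ^+ 2 * (E * H ^+ 2) by rewrite EH mulr1.
suff : y ^+ 3 * E <= 4 / c ^+ 2 * (E * H ^+ 2) by lra.
have -> : 4 / c ^+ 2 * (E * H ^+ 2) = 4 / c ^+ 2 * H ^+ 2 * E by ring.
apply: ler_wpM2r; first exact: ltW.
apply: (le_trans y34).
have -> : (y ^+ 2) ^+ 2 = 4 / c ^+ 2 * (c * y ^+ 2 / 2) ^+ 2 by field; rewrite gt_eqF.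
by apply: ler_wpM2l => //; rewrite divr_ge0// sqr_ge0.
Qed.

End TrigBounds.

(** * Complex numbers of modulus one and discrete orthogonality *)

Section UnitCircle.
Variable R : realType.
Local Notation C := R[i].
Local Notation normc := (@ComplexField.Normc.normc R).

Definition cis (x : R) : C := Complex (cos x) (sin x).

Lemma cis0 : cis 0 = 1.
Proof. by rewrite /cis cos0 sin0. Qed.

Lemma cisD x y : cis (x + y) = cis x * cis y.
Proof. by rewrite /cis cosD sinD; apply/eqP; rewrite eq_complex /= eqxx /= addrC eqxx. Qed.

Lemma cis_sum (I : finType) (f : I -> R) : cis (\sum_i f i) = \prod_i cis (f i).
Proof. by elim/big_ind2: _ => [|x a y b <- <-|//]; rewrite ?cis0 ?cisD. Qed.

Lemma cis_mulrn x k : cis (x *+ k) = cis x ^+ k.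
Proof. by elim: k => [|k IH]; rewrite ?mulr0n ?cis0// mulrS exprS cisD IH. Qed.

Lemma cis_2pi_int (q : int) : cis (2 * pi * q%:~R) = 1.
Proof.
have nat_case (k : nat) : cis (2 * pi * k%:R) = 1.
  by rewrite mulr_natr cis_mulrn /cis [2 * pi]mulr_natl cos2pi sin2pi expr1n.
case: q => k; first exact: nat_case.
have := cis0; rewrite -(subrr (2 * pi * k.+1%:R)) cisD nat_case mul1r.
by rewrite NegzE mulrNz mulrN.
Qed.

Lemma normcD (x y : C) : normc (x + y) <= normc x + normc y.
Proof. exact: le_normcD. Qed.

Lemma normc_ge0 (x : C) : 0 <= normc x.
Proof. by case: x => a b; exact: sqrtr_ge0. Qed.

Lemma normc_real (x : R) : normc x%:C%C = `|x|.
Proof. by rewrite /= expr0n addr0 sqrtr_sqr. Qed.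

Lemma normcX (x : C) k : normc (x ^+ k) = normc x ^+ k.
Proof.
elim: k => [|k IH]; first by rewrite !expr0 -[1 in LHS]/(1%:C%C) normc_real normr1.
by rewrite !exprS ComplexField.Normc.normcM IH.
Qed.

Lemma normc_sum (I : finType) (f : I -> C) : normc (\sum_i f i) <= \sum_i normc (f i).
Proof.
elim/big_ind2: _ => [|x a y b xa yb|//].
  by rewrite -[0 in leLHS]/(0%:C%C) normc_real normr0.
by apply: (le_trans (normcD _ _)); exact: lerD.
Qed.

Lemma ler_Re_normc (x : C) : `|Re x| <= normc x.
Proof.
case: x => a b /=; rewrite -[`|a|]sqrtr_sqr ler_sqrt ?lerDl ?sqr_ge0//.
by rewrite addr_ge0 ?sqr_ge0.
Qed.

Lemma normc_le_ReIm (a b : R) : normc (Complex a b) <= `|a| + `|b|.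
Proof.
rewrite /= -[leRHS]ger0_norm ?addr_ge0// -sqrtr_sqr ler_sqrt ?sqr_ge0//.
rewrite sqrrD !real_normK ?num_real//.
have : 0 <= `|a| * `|b| by rewrite mulr_ge0.
lra.
Qed.

(** A difference of powers factors with [k] terms of modulus at most [m ^+ k.-1]. This will compare
    powers of the characteristic function with powers of the Gaussian. *)
Lemma normc_subXX (x y : C) (m : R) k : normc x <= m -> normc y <= m ->
  normc (x ^+ k - y ^+ k) <= k%:R * normc (x - y) * m ^+ k.-1.
Proof.
move=> xm ym; rewrite subrXX ComplexField.Normc.normcM [k%:R * _]mulrC -mulrA.
apply: ler_wpM2l; first exact: normc_ge0.
apply: (le_trans (normc_sum _)).
have -> : k%:R * m ^+ k.-1 = \sum_(i < k) m ^+ k.-1 by rewrite sumr_const card_ord mulr_natl.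
apply: ler_sum => i _; rewrite ComplexField.Normc.normcM !normcX.
have -> : m ^+ k.-1 = m ^+ (k.-1 - i) * m ^+ i.
  by rewrite -exprD subnK//; case: k i => [[]|k i]//=; rewrite -ltnS.
by apply: ler_pM; rewrite ?exprn_ge0 ?normc_ge0// lerXn2r ?nnegrE ?normc_ge0// (le_trans (normc_ge0 _) xm).
Qed.

(** Orthogonality of the roots of unity of order [2 t + 1]: a geometric sum whose ratio [r] has
    [M]-th power 1 vanishes unless [r = 1]. *)
Lemma sum_cis_grid (t : nat) (q : int) : `|q| <= t%:Z ->
  \sum_(k < t.*2.+1) cis (2 * pi / t.*2.+1%:R * (k%:R - t%:R) * q%:~R)
    = (q == 0)%:R * t.*2.+1%:R :> C.
Proof.
move=> qt; set M := t.*2.+1.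
have M0 : 0 < M%:R :> R by rewrite ltr0n.
have [->|q0] := eqVneq q 0.
  under eq_bigr do rewrite mulr0 cis0.
  by rewrite sumr_const card_ord mul1r.
rewrite mul0r; set r := cis (2 * pi / M%:R * q%:~R).
under eq_bigr => k _.
  rewrite (_ : _ * _ * _ = (2 * pi / M%:R * q%:~R) *+ k - 2 * pi / M%:R * t%:R * q%:~R); last first.
    by rewrite -mulr_natr; field; rewrite gt_eqF.
  rewrite cisD cis_mulrn -/r; over.
rewrite -mulr_suml.
have rM : r ^+ M = 1.
  rewrite -cis_mulrn -(cis_2pi_int q); congr cis.
  by rewrite -mulr_natr; field; rewrite gt_eqF.
(* Comparing real parts, [r = 1] would force [sin (pi * q / M) = 0] by the half-angle formula,
   impossible for [0 < |q| <= t < M]. *)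
have r1 : r - 1 != 0.
  rewrite subr_eq0; apply/eqP => /(congr1 (@Re R)) /=.
  rewrite cosE_half => /eqP; rewrite -subr_eq0 addrAC subrr add0r oppr_eq0 mulf_eq0 pnatr_eq0 /=.
  rewrite sqrf_eq0; apply/negP.
  rewrite (_ : _ / 2 = pi / M%:R * q%:~R); last by field; rewrite gt_eqF.
  have pos (p : R) : 0 < p -> p <= t%:R -> 0 < sin (pi / M%:R * p).
    move=> p0 pt; apply: sin_gt0_pi; rewrite !mulr_gt0 ?pi_gt0 ?invr_gt0//=.
    rewrite mulrAC ltr_pdivrMr// ltr_pM2l ?pi_gt0//.
    by rewrite (le_lt_trans pt)// ltr_nat /M; lia.
  have [q1|q1] := ltP 0 q.
    rewrite gt_eqF// pos ?ltr0z//; rewrite gtr0_norm// in qt.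
    by rewrite -(ler_int R) in qt.
  rewrite -oppr_eq0 -sinN -mulrN -mulrNz gt_eqF// pos// ?ltr0z; first by lia.
  by rewrite ler0_norm// in qt; rewrite -(ler_int R) in qt.
have : (r - 1) * (\sum_(k < M) r ^+ k) = 0 by rewrite -subrX1 rM subrr.
by move/eqP; rewrite mulf_eq0 (negPf r1) /= => /eqP ->; rewrite mul0r.
Qed.

End UnitCircle.

(** * The local limit theorem *)

Section LatticeWalk.
Variables (R : realType) (K : finType) (n : nat) (w : K -> 'I_n -> bool).
Local Notation normc := (@ComplexField.Normc.normc R).
Local Notation N := (#|K|%:R : R).

Definition mean (i : 'I_n) : R := (\sum_S (w S i)%:R) / N.
Definition dev (S : K) (i : 'I_n) : R := (w S i)%:R - mean i.
Definition covmx : 'M[R]_n := \matrix_(i, j) ((\sum_S dev S i * dev S j) / N).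

(* The differences of the vectors [w S] generate the lattice Z^n. *)
Definition spanning := forall i : 'I_n, exists c : K -> int,
  \sum_S c S = 0 /\ forall j, \sum_S c S * (w S j)%:Z = (i == j)%:Z.

Definition walk_count (t : nat) (m : 'I_n -> nat) : nat :=
  #|[pred f : {ffun 'I_t -> K} | [forall i, (\sum_(j < t) w (f j) i)%N == m i]]|.

Implicit Types th : 'rV[R]_n.

Definition dot (th : 'rV[R]_n) (S : K) : R := \sum_i th 0 i * dev S i.
(** This is [#|K|] times the characteristic function of one centred uniform step. *)
Definition chf (th : 'rV[R]_n) : R[i] := \sum_S cis (dot th S).
Definition sqn (th : 'rV[R]_n) : R := \sum_i th 0 i ^+ 2.

Definition grid (t : nat) (f : {ffun 'I_n -> 'I_t.*2.+1}) : 'rV[int]_n :=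
  \row_i ((f i)%:Z - t%:Z).

(** Exact Fourier inversion by a finite sum: every coordinate of the end point of a walk differs
    from that of [m] by at most [t], so [2 t + 1] frequencies per coordinate detect equality. *)
Lemma walk_count_fourier (t : nat) (m : 'I_n -> nat) :
  (forall i, (m i)%:R = t%:R * mean i) ->
  (walk_count t m)%:R * t.*2.+1%:R ^+ n =
  \sum_(f : {ffun 'I_n -> 'I_t.*2.+1})
    chf ((2 * pi / t.*2.+1%:R) *: map_mx intr (grid f)) ^+ t.
Proof.
move=> mE; set M := t.*2.+1.
pose q (g : {ffun 'I_t -> K}) (i : 'I_n) : int := (\sum_(j < t) w (g j) i)%N%:Z - (m i)%:Z.
have w1 (S : K) i : (w S i <= 1)%N by case: (w S i).
have qt g i : `|q g i| <= t%:Z.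
  have : (\sum_(j < t) w (g j) i <= t)%N.
    rewrite -[X in (_ <= X)%N]card_ord -sum1_card; exact: leq_sum.
  have : (m i <= t)%N.
    rewrite -(ler_nat R) mE ler_piMr// /mean.
    have [N0|N0] := eqVneq N 0; first by rewrite N0 invr0 mulr0.
    rewrite ler_pdivrMr ?lt_def ?N0//= mul1r -[leRHS]/(#|K|%:R : R) -sum1_card natr_sum.
    by apply: ler_sum => S _; rewrite ler_nat.
  by rewrite /q; move: (\sum_(_ < _) _)%N => a; lia.
(* The power is expanded over all walks. As the target is [t] times the mean, the centred phase of a
   walk involves only its deviation [q] from the target. *)
have expand (f : {ffun 'I_n -> 'I_M}) :
    chf ((2 * pi / M%:R) *: map_mx intr (grid f)) ^+ t =
    \sum_(g : {ffun 'I_t -> K}) \prod_i cis (2 * pi / M%:R * ((f i)%:R - t%:R) * (q g i)%:~R).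
  have powE (z : R[i]) : z ^+ t = \prod_(j < t) z by rewrite prodr_const card_ord.
  rewrite powE bigA_distr_bigA /=.
  apply: eq_bigr => g _; rewrite -cis_sum -[RHS]cis_sum; congr cis.
  rewrite exchange_big /=; apply: eq_bigr => i _; rewrite !mxE -mulr_sumr.
  congr (_ * _); first by rewrite intrB.
  by rewrite /dev big_split /= sumr_const card_ord -mulr_natl mulrN -mE /q intrB -natr_sum.
under eq_bigr do rewrite expand.
rewrite exchange_big /=.
have inner (g : {ffun 'I_t -> K}) : \sum_(f : {ffun 'I_n -> 'I_M})
      \prod_i cis (2 * pi / M%:R * ((f i)%:R - t%:R) * (q g i)%:~R) =
    [forall i, (\sum_(j < t) w (g j) i)%N == m i]%:R * M%:R ^+ n :> R[i].
  rewrite -(bigA_distr_bigA (fun i (k : 'I_M) => cis (2 * pi / M%:R * (k%:R - t%:R) * (q g i)%:~R))) /=.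
  under eq_bigr do rewrite sum_cis_grid//.
  rewrite big_split /= prodr_const card_ord; congr (_ * _).
  case: forallP => [all_eq|some].
    by apply: big1 => i _; rewrite /q (eqP (all_eq i)) subrr eqxx.
  apply/eqP/prodf_eq0; move/forallP: (some) => /forallPn[i ni].
  by exists i => //; rewrite pnatr_eq0 eqb0 /q subr_eq0 eqz_nat.
under [RHS]eq_bigr do rewrite inner.
rewrite -mulr_suml; congr (_ * _).
rewrite /walk_count -sum1_card natr_sum big_mkcond /=; apply: eq_bigr => g _.
by rewrite inE; case: ifP.
Qed.

Lemma dev_sum i : (0 < #|K|)%N -> \sum_S dev S i = 0.
Proof.
move=> K0; rewrite /dev big_split /= sumr_const -mulr_natl mulrN /mean.
by rewrite mulrC divfK ?subrr// pnatr_eq0 -lt0n.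
Qed.

Lemma dot_sum th : (0 < #|K|)%N -> \sum_S dot th S = 0.
Proof.
move=> K0; rewrite exchange_big /= big1// => i _.
by rewrite -mulr_sumr dev_sum// mulr0.
Qed.

Lemma dev_le1 S i : `|dev S i| <= 1.
Proof.
have m0 : 0 <= mean i <= 1.
  rewrite /mean divr_ge0//=; last by apply: sumr_ge0.
  have [N0|N0] := eqVneq N 0; first by rewrite N0 invr0 mulr0.
  rewrite ler_pdivrMr ?lt_def ?N0//= mul1r -[leRHS]/(#|K|%:R : R) -sum1_card natr_sum.
  by apply: ler_sum => T _; rewrite ler_nat; case: (w T i).
by rewrite /dev ler_norml; case: (w S i) => /=; lra.
Qed.

Lemma quad_covmx th : quad covmx th = (\sum_S dot th S ^+ 2) / N.
Proof.
rewrite /quad mxE mulr_suml.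
under [RHS]eq_bigr => S _.
  rewrite expr2 {2}/dot mulr_sumr mulr_suml; over.
rewrite exchange_big /=; apply: eq_bigr => j _; rewrite !mxE mulr_suml.
under [RHS]eq_bigr => S _.
  rewrite /dot mulr_suml mulr_suml; over.
rewrite exchange_big /=; apply: eq_bigr => i _; rewrite !mxE.
rewrite !(mulr_suml, mulr_sumr); apply: eq_bigr => S _; ring.
Qed.

Lemma quad_scalar (a : R) th : quad a%:M th = a * sqn th.
Proof.
rewrite /quad mul_mx_scalar -scalemxAl !mxE; congr (_ * _).
by apply: eq_bigr => i _; rewrite !mxE expr2.
Qed.

(** Coefficients of sum zero annihilate both the means hidden in [dev] and the constant [g]; what is
    left is the [i]-th unit vector paired with [th]. *)
Lemma spanning_coord i (c : K -> int) th (g : R) :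
  \sum_S c S = 0 -> (forall j, \sum_S c S * (w S j)%:Z = (i == j)%:Z) ->
  th 0 i = \sum_S (c S)%:~R * (dot th S - g).
Proof.
move=> c0 ci.
have c0R : \sum_S (c S)%:~R = 0 :> R by rewrite -(rmorph_sum (intmul (1 : R))) /= c0.
under eq_bigr do rewrite mulrBr.
rewrite sumrB -mulr_suml c0R mul0r subr0 /dot.
under eq_bigr do rewrite mulr_sumr.
rewrite exchange_big /=.
have inner j : \sum_S (c S)%:~R * (th 0 j * dev S j) = th 0 j * (i == j)%:R.
  have -> : ((i == j)%:R : R) = \sum_S (c S)%:~R * (w S j)%:R.
    rewrite -[(i == j)%:R]/(((i == j)%:Z)%:~R) -ci rmorph_sum /=.
    by apply: eq_bigr => S _; rewrite intrM.
  rewrite (eq_bigr (fun S => th 0 j * ((c S)%:~R * (w S j)%:R) - th 0 j * mean j * (c S)%:~R)).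
    by rewrite sumrB -!mulr_sumr c0R mulr0 subr0.
  by move=> S _; rewrite /dev; ring.
under eq_bigr do rewrite inner.
rewrite (bigD1 i)//= eqxx mulr1 big1 ?addr0// => j ji.
by rewrite eq_sym (negPf ji) mulr0.
Qed.

Lemma weighted_sum_sqr_le (c : K -> int) (y : K -> R) (V : R) :
  (forall S, 0 <= y S) -> (forall S, y S ^+ 2 <= V) ->
  (\sum_S `|c S|%:~R * y S) ^+ 2 <= (\sum_S `|c S|%:~R) ^+ 2 * V.
Proof.
move=> y0 yV.
have [S0 _|noS] := pickP K; last first.
  by rewrite !big1 ?expr0n ?mul0r// => S; have := noS S.
have V0 : 0 <= V by apply: le_trans (yV S0); rewrite sqr_ge0.
have c0 S : 0 <= `|c S|%:~R :> R by rewrite ler0z.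
have -> : (\sum_S `|c S|%:~R) ^+ 2 * V = (\sum_S `|c S|%:~R * Num.sqrt V) ^+ 2.
  by rewrite -mulr_suml exprMn sqr_sqrtr.
rewrite ler_sqr ?nnegrE.
- apply: ler_sum => S _; apply: ler_wpM2l => //.
  by rewrite -[leLHS]ger0_norm// -sqrtr_sqr ler_sqrt.
- by apply: sumr_ge0 => S _; rewrite mulr_ge0.
- by apply: sumr_ge0 => S _; rewrite mulr_ge0 ?sqrtr_ge0.
Qed.

Lemma chfE th : chf th = Complex (\sum_S cos (dot th S)) (\sum_S sin (dot th S)).
Proof. by rewrite /chf; elim/big_rec3: _ => [//|S x y z _ ->]. Qed.

(** The squared modulus is the double sum of the cosines of all phase differences. Of the loss
    against [N ^+ 2] only the pairs involving the fixed [S0] are kept. *)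
Lemma chf_sqr th S0 :
  normc (chf th) ^+ 2 <= N ^+ 2 - 2 * \sum_S sin ((dot th S - dot th S0) / 2) ^+ 2.
Proof.
rewrite chfE /= sqr_sqrtr ?addr_ge0 ?sqr_ge0// !expr2 !big_distrlr -big_split /=.
under eq_bigr => S _.
  rewrite -big_split /=.
  under eq_bigr do rewrite -cosB cosE_half.
  rewrite sumrB sumr_const -mulr_sumr; over.
rewrite sumrB sumr_const -mulr_sumr; apply: lerB.
  by rewrite -[leLHS]mulr_natl.
rewrite ler_pM2l//.
apply: ler_sum => S _; rewrite (bigD1 S0)//= lerDl.
by apply: sumr_ge0 => T _; rewrite sqr_ge0.
Qed.

Hypothesis K0 : (0 < #|K|)%N.
Hypothesis sp : spanning.

Let N0 : 0 < N. Proof. by rewrite ltr0n. Qed.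

(** Smallness of [F] on the phases passes to the coordinates of [th] through the integer
    combinations of [spanning]. [F] is left abstract to serve twice: the sine of the half angle for
    the modulus of [chf], the identity for the covariance form. *)
Lemma spanning_sqn : exists2 D : R, 0 < D &
  forall (th : 'rV[R]_n) (F : R -> R) (g V : R),
    (forall c : K -> int, `|F (\sum_S (c S)%:~R * (dot th S - g))| <= \sum_S `|c S|%:~R * `|F (dot th S - g)|) ->
    (forall S, F (dot th S - g) ^+ 2 <= V) ->
    \sum_i F (th 0 i) ^+ 2 <= D * V.
Proof.
have [C HC] := choice sp.
pose b i := (\sum_S `|C i S|%:~R) ^+ 2 : R.
(* The summand 1 keeps the constant positive even in dimension 0. *)
exists (1 + \sum_i b i); first by rewrite ltr_pwDl// sumr_ge0// => i _; rewrite sqr_ge0.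
move=> th F g V Fle FV.
have [S0 _|noS] := pickP K; last by move: K0; rewrite (eq_card0 noS).
have V0 : 0 <= V by apply: le_trans (FV S0); rewrite sqr_ge0.
rewrite mulrDl mul1r mulr_suml ler_wpDl//; apply: ler_sum => i _.
have [c0 ci] := HC i.
rewrite (spanning_coord th g c0 ci) -real_normK ?num_real//.
apply: (@le_trans _ _ ((\sum_S `|C i S|%:~R * `|F (dot th S - g)|) ^+ 2)).
  rewrite ler_sqr ?nnegrE//; apply: sumr_ge0 => S _; rewrite mulr_ge0// ler0z//.
apply: weighted_sum_sqr_le => // S; by rewrite real_normK ?num_real.
Qed.

(** The loss [V] in the squared modulus controls the squared sines of all [th 0 i / 2], and on the
    cube Jordan's inequality replaces these sines by the coordinates themselves. Then
    [1 + x <= expR x] gives the Gaussian form. *)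
Lemma chf_gauss_bound : exists2 c : R, 0 < c &
  forall th : 'rV[R]_n, (forall i, `|th 0 i| <= pi) ->
    normc (chf th) / N <= expR (- (c * sqn th)).
Proof.
have [D D0 HD] := spanning_sqn.
have pi0 := pi_gt0 R.
have [S0 _|noS] := pickP K; last by move: K0; rewrite (eq_card0 noS).
exists (1 / (N ^+ 2 * pi ^+ 2 * D)).
  by rewrite divr_gt0// !mulr_gt0 ?exprn_gt0.
move=> th thpi; set V := \sum_S sin ((dot th S - dot th S0) / 2) ^+ 2.
have sqnV : sqn th <= pi ^+ 2 * (D * V).
  have h : \sum_i sin (th 0 i / 2) ^+ 2 <= D * V.
    apply: (HD th (fun x => sin (x / 2)) (dot th S0) V) => [c|S] /=.
      rewrite mulr_suml (eq_bigr (fun S => (c S)%:~R * ((dot th S - dot th S0) / 2))).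
        exact: ler_norm_sin_sum.
      by move=> S _; rewrite mulrA.
    by rewrite /V (bigD1 S)//= lerDl sumr_ge0// => T _; rewrite sqr_ge0.
  apply: le_trans (ler_wpM2l (sqr_ge0 _) h); rewrite /sqn mulr_sumr.
  apply: ler_sum => i _; have := jordan_sin (thpi i).
  rewrite ler_pdivrMr// => l; rewrite -exprMn -real_normK ?num_real// -[leRHS]real_normK ?num_real//.
  by rewrite ler_sqr ?nnegrE// normrM (gtr0_norm pi0) mulrC.
have le2 : (normc (chf th) / N) ^+ 2 <= expR (- (V / N ^+ 2)) ^+ 2.
  rewrite exprMn exprVn ler_pdivrMr ?exprn_gt0//.
  apply: (le_trans (chf_sqr th S0)); rewrite -/V.
  have -> : N ^+ 2 - 2 * V = (1 + - (2 * V / N ^+ 2)) * N ^+ 2 by field; rewrite gt_eqF.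
  apply: ler_wpM2r; first exact: sqr_ge0.
  apply: (le_trans (expR_ge1Dx _)); rewrite [leRHS]expr2 -expRD ler_expR; lra.
apply: (@le_trans _ _ (expR (- (V / N ^+ 2)))).
  by move: le2; rewrite ler_sqr ?nnegrE ?expR_ge0// divr_ge0// ?normc_ge0 ?ltW.
rewrite ler_expR lerN2 mul1r mulrC ler_pdivrMr; last by rewrite !mulr_gt0 ?exprn_gt0.
have -> : V / N ^+ 2 * (N ^+ 2 * pi ^+ 2 * D) = pi ^+ 2 * (D * V) by field; rewrite gt_eqF.
exact: sqnV.
Qed.

(** The linear counterpart of the previous bound: the form is the mean square of the phases, which
    determine [th]. *)
Lemma covmx_lower : exists2 c : R, 0 < c & forall th : 'rV[R]_n, c * sqn th <= quad covmx th.
Proof.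
have [D D0 HD] := spanning_sqn.
exists (1 / (N * D)); first by rewrite divr_gt0// mulr_gt0.
move=> th; have h : sqn th <= D * \sum_S dot th S ^+ 2.
  apply: (HD th id 0) => [c|S] /=.
    apply: (le_trans (ler_norm_sum _ _ _)); apply: ler_sum => S _.
    by rewrite normrM -intr_norm.
  by rewrite subr0 (bigD1 S)//= lerDl sumr_ge0// => T _; rewrite sqr_ge0.
rewrite quad_covmx mul1r mulrC ler_pdivrMr ?mulr_gt0//.
by rewrite (_ : _ / N * (N * D) = D * \sum_S dot th S ^+ 2)//; field; rewrite gt_eqF.
Qed.

Lemma covmx_posdef : posdef covmx.
Proof.
split; first by apply/matrixP => i j; rewrite !mxE; congr (_ / _); apply: eq_bigr => S _; rewrite mulrC.
move=> x x0; have [c c0 /(_ x)] := covmx_lower; apply: lt_le_trans.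
rewrite mulr_gt0// lt_def sumr_ge0 ?andbT; last by move=> i _; rewrite sqr_ge0.
apply: contra_neq x0 => s0; apply/rowP => i; rewrite mxE.
move/eqP: s0; rewrite psumr_eq0; last by move=> j _; rewrite sqr_ge0.
by move=> /allP/(_ i (mem_index_enum i)) /=; rewrite sqrf_eq0 => /eqP.
Qed.

(** Both sides agree to second order: the linear term vanishes because the step is centred, and the
    mean of the squared phases is the form [Q]. The cubic term bounds the Taylor error of the
    phases, the quartic one that of [expR (- Q / 2)]. *)
Lemma chf_taylor th (r : R) : (forall S, `|dot th S| <= r) ->
  normc (chf th / N%:C%C - (expR (- quad covmx th / 2))%:C%C) <= 2 * r ^+ 3 + r ^+ 4.
Proof.
move=> dr.
have r0 : 0 <= r.
  have [S0 _|noS] := pickP K; last by move: K0; rewrite (eq_card0 noS).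
  exact: le_trans (dr S0).
set Q := quad covmx th.
have NC : N%:C%C != 0 :> R[i] by rewrite (inj_eq (@complexI R) N 0) gt_eqF.
have Qr : 0 <= Q <= r ^+ 2.
  rewrite /Q quad_covmx divr_ge0 ?(ltW N0) ?sumr_ge0//=; last by move=> S _; rewrite sqr_ge0.
  rewrite ler_pdivrMr// (_ : r ^+ 2 * N = \sum_(S : K) r ^+ 2); last by rewrite sumr_const mulr_natr.
  apply: ler_sum => S _; rewrite -real_normK ?num_real// ler_sqr ?nnegrE//.
have split_eq : chf th / N%:C%C - (expR (- Q / 2))%:C%C =
    (\sum_S (cis (dot th S) - Complex (1 - dot th S ^+ 2 / 2) (dot th S))) / N%:C%C
    - (expR (- (Q / 2)) - 1 + Q / 2)%:C%C.
  rewrite sumrB mulrBl -/(chf th).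
  have -> : \sum_S Complex (1 - dot th S ^+ 2 / 2) (dot th S) = (N * (1 - Q / 2))%:C%C.
    transitivity (Complex (\sum_S (1 - dot th S ^+ 2 / 2)) (\sum_S dot th S)).
      by elim/big_rec3: _ => [//|S x y z _ ->].
    rewrite dot_sum//; congr Complex.
    rewrite sumrB sumr_const -mulr_suml /Q quad_covmx; field.
    by rewrite gt_eqF.
  rewrite (rmorphM (real_complex R)) /= mulrAC divff// mul1r -addrA -opprD; congr (_ - _).
  rewrite -(rmorphD (real_complex R)); congr (_%:C)%C.
  by rewrite mulNr; ring.
rewrite split_eq; apply: (le_trans (normcD _ _)); apply: lerD.
  rewrite ComplexField.Normc.normcM ComplexField.Normc.normcV normc_real (gtr0_norm N0) ler_pdivrMr//.
  apply: (le_trans (normc_sum _)).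
  rewrite (_ : 2 * r ^+ 3 * N = \sum_(S : K) 2 * r ^+ 3); last by rewrite sumr_const mulr_natr.
  apply: ler_sum => S _; rewrite /cis.
  set x := dot th S.
  have -> : Complex (cos x) (sin x) - Complex (1 - x ^+ 2 / 2) x =
     Complex (cos x - 1 + x ^+ 2 / 2) (sin x - x).
     by apply/eqP; rewrite eq_complex /= eqxx andbT; apply/eqP; ring.
  apply: (le_trans (normc_le_ReIm _ _)).
  have x3 : `|x| ^+ 3 <= r ^+ 3 by rewrite lerXn2r ?nnegrE ?dr.
  have := cos_taylor_le x; have := sin_sub_id_le x.
  have : 0 <= `|x| ^+ 3 by rewrite exprn_ge0.
  lra.
rewrite -(rmorphN (real_complex R)) normc_real normrN.
have Q0 : 0 <= Q / 2 by lra.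
apply: (le_trans (expR_taylor_le Q0)).
have : Q ^+ 2 <= (r ^+ 2) ^+ 2 by rewrite ler_sqr ?nnegrE; lra.
rewrite -exprM [(Q / 2) ^+ 2]exprMn; have := sqr_ge0 Q; lra.
Qed.

End LatticeWalk.

(** * Comparing a finite sum with an infinite one *)

Section EsumSandwich.
Variable R : realType.

Lemma esum_finType (F : finType) (a : F -> \bar R) : (forall f, 0 <= a f)%E ->
  (\esum_(f in [set: F]) a f = \sum_(f : F) a f)%E.
Proof.
move=> a0; have fin : finite_set [set: F] := finite_finset.
rewrite esum_fset// fsbig_finite//=; apply: perm_big.
apply: uniq_perm; rewrite ?finmap.fset_uniq ?index_enum_uniq// => x.
by rewrite in_fset_set// in_setT mem_index_enum.
Qed.

Lemma esum_split_image (T : choiceType) (F : finType) (iota : F -> T) (B : T -> R) :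
  injective iota -> (forall z, 0 <= B z) ->
  (\esum_(z in [set: T]) (B z)%:E =
   (\sum_f B (iota f))%:E + \esum_(z in ~` range iota) (B z)%:E)%E.
Proof.
move=> ioI B0; rewrite (esumID (range iota)); last by move=> z _; rewrite lee_fin.
rewrite !setTI; congr (_ + _)%E.
rewrite esum_image; last by move=> x y _ _ /ioI.
by rewrite esum_finType ?sumEFin// => f; rewrite lee_fin.
Qed.

(** The same summable majorant [eps * D] bounds the error on the image of [iota] and the neglected
    tail of [B] outside it, so the two contributions add up to one full sum of [D]. *)
Lemma esum_sandwich (T : choiceType) (F : finType) (iota : F -> T)
    (A : F -> R) (B D : T -> R) (eps : R) : injective iota -> 0 <= eps ->
  (forall z, 0 <= B z) -> (forall z, 0 <= D z) ->
  (forall f, `|A f - B (iota f)| <= eps * D (iota f)) ->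
  (forall z, (~` range iota) z -> B z <= eps * D z) ->
  (\esum_(z in [set: T]) (B z)%:E \is a fin_num)%E ->
  (\esum_(z in [set: T]) (D z)%:E \is a fin_num)%E ->
  `|\sum_f A f - fine (\esum_(z in [set: T]) (B z)%:E)| <=
    eps * fine (\esum_(z in [set: T]) (D z)%:E).
Proof.
move=> ioI e0 B0 D0 AB BD; rewrite !(esum_split_image ioI)//.
set tB := (\esum_(z in _) (B z)%:E)%E; set tD := (\esum_(z in _) (D z)%:E)%E.
have tB0 : (0 <= tB)%E by apply: esum_ge0 => z _; rewrite lee_fin.
have tD0 : (0 <= tD)%E by apply: esum_ge0 => z _; rewrite lee_fin.
have tBD : (tB <= eps%:E * tD)%E.
  rewrite -esumZl//.
  by apply: le_esum => z nz; rewrite -EFinM lee_fin BD.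
rewrite !fin_numD /= => fB fD.
rewrite -(fineK fB) -(fineK fD) -EFinM lee_fin in tBD.
rewrite -(fineK fB) lee_fin in tB0.
rewrite !fineD//=; rewrite opprD addrA mulrDr.
apply: (le_trans (ler_normB _ _)); apply: lerD; last by rewrite ger0_norm.
rewrite -sumrB mulr_sumr; apply: (le_trans (ler_norm_sum _ _ _)).
exact: ler_sum.
Qed.

End EsumSandwich.

(** * Gaussian approximation on the grid and passage to the limit *)

Section LocalLimit.
Variables (R : realType) (K : finType) (n : nat) (w : K -> 'I_n -> bool).
Hypothesis K0 : (0 < #|K|)%N.
Hypothesis sp : spanning w.
Local Notation normc := (@ComplexField.Normc.normc R).
Local Notation N := (#|K|%:R : R).
Implicit Type th : 'rV[R]_n.

Let N0 : 0 < N. Proof. by rewrite ltr0n. Qed.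

Lemma sqn_ge0 th : 0 <= sqn th.
Proof. by apply: sumr_ge0 => i _; rewrite sqr_ge0. Qed.

Lemma coord_le_sqn th i : th 0 i ^+ 2 <= sqn th.
Proof. by rewrite /sqn (bigD1 i)//= lerDl sumr_ge0// => j _; rewrite sqr_ge0. Qed.

Lemma dot_le_sqn th S : `|dot w th S| <= n%:R * Num.sqrt (sqn th).
Proof.
have -> : n%:R * Num.sqrt (sqn th) = \sum_(i < n) Num.sqrt (sqn th).
  by rewrite sumr_const card_ord mulr_natl.
apply: (le_trans (ler_norm_sum _ _ _)); apply: ler_sum => i _; rewrite normrM.
apply: (@le_trans _ _ `|th 0 i|); first by rewrite ler_piMr// dev_le1.
by rewrite -sqrtr_sqr ler_sqrt ?sqn_ge0// coord_le_sqn.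
Qed.

(** Replacing the [t] factors one by one costs [t * r ^+ 3 * m ^+ t.-1] up to a constant, where [r]
    is of order [|th|]. In terms of [y = sqrt t * r] the factor [t * r ^+ 3] is [y ^+ 3 / sqrt t],
    and half of the exponential decay absorbs the cube. *)
Lemma chf_pow_error : exists C c : R, [/\ 0 < C, 0 < c &
  forall (t : nat) th, (2 <= t)%N -> (forall i, `|th 0 i| <= pi) ->
    `|Re ((chf w th / N%:C%C) ^+ t) - expR (- (t%:R * quad (covmx R w) th) / 2)|
      <= C / Num.sqrt t%:R * expR (- (c * (t%:R * sqn th)))].
Proof.
have [c1 c10 H1] := chf_gauss_bound R K0 sp.
have [c2 c20 H2] := covmx_lower R K0 sp.
(* With this rate [m] bounds both the normalised characteristic function and the Gaussian. *)
pose c0 := Num.min c1 (c2 / 2).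
have c00 : 0 < c0 by rewrite lt_min c10 divr_gt0.
have pi0 := pi_gt0 R.
pose B : R := n%:R ^+ 2 * pi.
have B0 : 0 <= B by rewrite mulr_ge0 ?sqr_ge0// ltW.
(* Chosen so that [c' * (sqrt t * r) ^+ 2 <= c0 / 4 * t * s], as [r ^+ 2 = n ^+ 2 * s]; the 1 avoids
   a zero denominator in dimension 0. *)
pose c' := c0 / (4 * (n%:R ^+ 2 + 1)).
have n1 : 0 < n%:R ^+ 2 + 1 :> R by rewrite ltr_wpDl ?sqr_ge0.
have c'0 : 0 < c' by rewrite divr_gt0// mulr_gt0.
exists ((2 + B) * (1 + 4 / c' ^+ 2)), (c0 / 4); split.
- rewrite mulr_gt0//; first lra.
  by rewrite ltr_pwDl// divr_ge0// sqr_ge0.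
- lra.
move=> t th t2 thpi.
have t0 : 0 < t%:R :> R by rewrite ltr0n; lia.
set s := sqn th; have s0 : 0 <= s := sqn_ge0 th.
set Q := quad _ th.
set r := n%:R * Num.sqrt s.
have r0 : 0 <= r by rewrite mulr_ge0// sqrtr_ge0.
have rB : r <= B.
  rewrite /B expr2 -mulrA; apply: ler_wpM2l => //.
  rewrite -[leRHS]ger0_norm ?mulr_ge0 ?(ltW pi0)// -sqrtr_sqr ler_sqrt ?sqr_ge0//.
  apply: (@le_trans _ _ (\sum_(i < n) pi ^+ 2)).
    apply: ler_sum => i _; rewrite -real_normK ?num_real// ler_sqr ?nnegrE//.
    exact: ltW.
  rewrite sumr_const card_ord -[leLHS]mulr_natl [leRHS]exprMn; apply: ler_wpM2r; first exact: sqr_ge0.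
  by rewrite -natrX ler_nat; case: (n) => // k; rewrite expnS leq_pmulr// expn_gt0.
set m := expR (- (c0 * s)).
have phi_le : normc (chf w th / N%:C%C) <= m.
  rewrite ComplexField.Normc.normcM ComplexField.Normc.normcV normc_real (gtr0_norm N0).
  apply: (le_trans (H1 th thpi)); rewrite ler_expR lerN2 -/s.
  by apply: ler_wpM2r => //; rewrite ge_min lexx.
have gau_le : normc (expR (- Q / 2))%:C%C <= m.
  rewrite normc_real ger0_norm ?expR_ge0// ler_expR mulNr lerN2.
  apply: (@le_trans _ _ (c2 / 2 * s)); first by apply: ler_wpM2r => //; rewrite ge_min lexx orbT.
  by have := H2 th; rewrite -/s -/Q; lra.
have tay := chf_taylor K0 (dot_le_sqn th); rewrite -/s -/r -/Q in tay.
have pw := normc_subXX t phi_le gau_le.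
have -> : expR (- (t%:R * Q) / 2) = Re ((expR (- Q / 2))%:C%C ^+ t : R[i]).
  rewrite -(rmorphXn (real_complex R)) /= -expRM_natl; congr expR; ring.
rewrite -raddfB; apply: (le_trans (ler_Re_normc _)); apply: (le_trans pw).
have m0 : 0 <= m by rewrite expR_ge0.
set d := normc _ in tay *.
have d3 : d <= (2 + B) * r ^+ 3.
  apply: (le_trans tay); rewrite exprS [r ^+ 4]exprS.
  have : r * r ^+ 3 <= B * r ^+ 3 by apply: ler_wpM2r => //; rewrite exprn_ge0.
  rewrite !exprS; lra.
set E1 := expR (- (c0 / 4 * (t%:R * s))).
(* Here [t >= 2] enters, through [t - 1 >= t / 2]. One factor [E1] will absorb the cube, the other
   stays in the bound. *)
have mE : m ^+ t.-1 <= E1 * E1.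
  rewrite /m /E1 -expRM_natl -expRD ler_expR.
  have -> : t.-1%:R = t%:R - 1 :> R by rewrite -[in RHS](prednK (ltnW t2)) -natr1 addrK.
  have : 0 <= (t%:R - 2) * (c0 * s).
    by rewrite !mulr_ge0 ?(ltW c00)// subr_ge0 ler_nat.
  lra.
have E10 : 0 < E1 := expR_gt0 _.
set st := Num.sqrt t%:R.
have st0 : 0 < st by rewrite sqrtr_gt0.
have st2 : st ^+ 2 = t%:R by rewrite sqr_sqrtr// ltW.
have E1y : E1 <= expR (- (c' * (st * r) ^+ 2)).
  rewrite ler_expR lerN2 exprMn st2 /r exprMn sqr_sqrtr// /c'.
  have -> : c0 / (4 * (n%:R ^+ 2 + 1)) * (t%:R * (n%:R ^+ 2 * s)) =
    c0 / 4 * (t%:R * s) * (n%:R ^+ 2 / (n%:R ^+ 2 + 1)) by field; rewrite gt_eqF.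
  rewrite ler_piMr//; first by rewrite !mulr_ge0// ?ltW// divr_ge0// ltW.
  by rewrite ler_pdivrMr// mul1r lerDl.
have cube := cube_expR_le c'0 (mulr_ge0 (ltW st0) r0).
have y0 : 0 <= (st * r) ^+ 3 by rewrite exprn_ge0// mulr_ge0// ltW.
apply: (@le_trans _ _ ((2 + B) / st * ((st * r) ^+ 3 * E1) * E1)).
  have -> : (2 + B) / st * ((st * r) ^+ 3 * E1) * E1 = t%:R * ((2 + B) * r ^+ 3) * (E1 * E1).
    by rewrite -st2; field; rewrite gt_eqF.
  apply: ler_pM => //.
  - by rewrite mulr_ge0// ?(ltW t0)// normc_ge0.
  - by rewrite exprn_ge0.
  - by rewrite ler_pM2l.
rewrite [leRHS](_ : _ = (2 + B) / st * (1 + 4 / c' ^+ 2) * E1); last by ring.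
apply: ler_wpM2r; first exact: ltW.
apply: ler_wpM2l; first by rewrite divr_ge0 ?(ltW st0)//; lra.
apply: le_trans cube; exact: ler_wpM2l.
Qed.

(** Outside the cube [sqn th >= 1], so half of the exponent already yields [expR (- (c2 / 4 * t))],
    which is at most [4 / (c2 * t)]. *)
Lemma gauss_tail_error : exists C c : R, [/\ 0 < C, 0 < c &
  forall (t : nat) th i, (0 < t)%N -> pi < `|th 0 i| ->
    expR (- (t%:R * quad (covmx R w) th) / 2)
      <= C / Num.sqrt t%:R * expR (- (c * (t%:R * sqn th)))].
Proof.
have [c2 c20 H2] := covmx_lower R K0 sp.
exists (4 / c2), (c2 / 4); split; [by rewrite divr_gt0|by rewrite divr_gt0|].
move=> t th i t0 thi.
have t1 : 1 <= t%:R :> R by rewrite ler1n.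
have s1 : 1 <= sqn th.
  apply: le_trans (coord_le_sqn th i); rewrite -real_normK ?num_real//.
  have := pi_ge2 R; nra.
have h := H2 th; set s := sqn th in s1 h *; set Q := quad _ th in h *.
set E := expR (- (c2 / 4 * (t%:R * s))).
apply: (@le_trans _ _ (E * E)).
  rewrite -expRD ler_expR.
  have : t%:R * (c2 * s) <= t%:R * Q by apply: ler_wpM2l => //; lra.
  nra.
apply: ler_wpM2r; first exact: expR_ge0.
have x0 : 0 < c2 / 4 * t%:R by rewrite mulr_gt0 ?divr_gt0//; lra.
apply: (@le_trans _ _ (expR (- (c2 / 4 * t%:R)))).
  rewrite ler_expR lerN2; apply: ler_wpM2l; first by lra.
  by rewrite ler_peMr//; lra.
apply: (@le_trans _ _ (c2 / 4 * t%:R)^-1).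
  rewrite expRN lef_pV2 ?posrE ?expR_gt0//.
  have := expR_ge1Dx (c2 / 4 * t%:R); lra.
rewrite invfM invf_div; apply: ler_wpM2l; first by rewrite divr_ge0// ltW.
rewrite lef_pV2 ?posrE ?sqrtr_gt0; [|lra|lra].
have := sqr_sqrtr (ler0n R t); have : 1 <= Num.sqrt (t%:R : R) by rewrite -[leLHS]sqrtr1 ler_sqrt.
nra.
Qed.

(** The spacing of the frequency grid in the rescaled variable [sqrt t * th]; it tends to 0 like
    [pi / sqrt t]. *)
Definition mesh (t : nat) : R := 2 * pi * Num.sqrt t%:R / t.*2.+1%:R.

Lemma mesh_gt0 t : (0 < t)%N -> 0 < mesh t.
Proof. by move=> t0; rewrite divr_gt0// !mulr_gt0 ?pi_gt0// sqrtr_gt0 ltr0n. Qed.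

Lemma cvg_sqrt_inv : (Num.sqrt (t%:R : R))^-1 @[t --> \oo] --> (0 : R).
Proof.
have -> : (fun t : nat => (Num.sqrt (t%:R : R))^-1) = fun t => Num.sqrt (t%:R^-1 : R).
  by apply/funext => t; rewrite sqrtrV.
rewrite -sqrtr0; apply: continuous_cvg; first exact: sqrt_continuous.
apply/(gtr0_cvgV0 (f := fun t : nat => t%:R : R)); last exact: cvgr_idn.
by near=> t; rewrite ltr0n; near: t; exact: nbhs_infty_gt.
Unshelve. all: by end_near.
Qed.

Lemma cvg_mesh : mesh t @[t --> \oo] --> 0^'+.
Proof.
have cvg0 : mesh t @[t --> \oo] --> 0.
  apply: (@squeeze_cvgr _ _ _ _ (fun=> 0) (fun t => 2 * pi * (Num.sqrt (t%:R : R))^-1)).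
  - near=> t.
    have t0 : (0 < t)%N by near: t; exact: nbhs_infty_gt.
    rewrite ltW ?mesh_gt0//= /mesh -!mulrA !ler_pM2l ?pi_gt0//.
    have s0 : 0 < Num.sqrt (t%:R : R) by rewrite sqrtr_gt0 ltr0n.
    rewrite ler_pdivrMr// mulrC ler_pdivlMr// -expr2 sqr_sqrtr// ler_nat; lia.
  - exact: cvg_cst.
  - rewrite -[X in _ --> X](mulr0 (2 * pi)); apply: cvgM; first exact: cvg_cst.
    exact: cvg_sqrt_inv.
move=> A A0; have /= := cvg0 _ A0; near_simpl => H; near=> t.
have : 0 < mesh t -> A (mesh t) by near: t.
apply; apply: mesh_gt0; near: t; exact: nbhs_infty_gt.
Unshelve. all: by end_near. Qed.

Lemma quadZ p (A : 'M[R]_p) (a : R) x : quad A (a *: x) = a ^+ 2 * quad A x.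
Proof. by rewrite /quad linearZ /= -scalemxAl -scalemxAl -scalemxAr scalerA mxE expr2. Qed.

Lemma grid_inj t : injective (@grid n t).
Proof.
move=> f g /rowP fg; apply/ffunP => i; have := fg i; rewrite !mxE => /addIr [].
exact: val_inj.
Qed.

Lemma grid_coord t (f : {ffun 'I_n -> 'I_t.*2.+1}) i : `|grid f 0 i| <= t%:Z.
Proof. by rewrite mxE; have := ltn_ord (f i); lia. Qed.

Lemma notin_grid t (z : 'rV[int]_n) : (~` range (@grid n t)) z -> exists i, t%:Z < `|z 0 i|.
Proof.
move=> nz; apply: contrapT => none; apply: nz.
have zt i : `|z 0 i| <= t%:Z by rewrite leNgt; apply/negP => zi; apply: none; exists i.
exists [ffun i => inord (absz (z 0 i + t%:Z))] => //.
apply/rowP => i; rewrite mxE ffunE inordK; have := zt i; lia.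
Qed.

Lemma mesh_angle t : 0 <= mesh t /\ mesh t ^+ 2 = t%:R * (2 * pi / t.*2.+1%:R) ^+ 2.
Proof.
split; first by rewrite divr_ge0// !mulr_ge0 ?sqrtr_ge0 ?pi_ge0.
by rewrite /mesh -!mulrA !exprMn sqr_sqrtr//; ring.
Qed.

(** Fourier inversion makes the normalised count a finite grid sum, which differs from the Gaussian
    sum of the covariance form by [O(1 / sqrt t)] times a second Gaussian sum. Both Gaussian sums
    converge as the mesh tends to 0. *)
Theorem local_limit (P : set nat) (m : nat -> 'I_n -> nat) :
  (forall t, P t -> forall i, (m t i)%:R = t%:R * mean R w i) ->
  (walk_count w t (m t))%:R / N ^+ t *
      Num.sqrt ((2 * pi * t%:R) ^+ n * \det (covmx R w)) @[t --> within P \oo] --> (1 : R).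
Proof.
move=> mE.
have [C1 [c1 [C10 c10 H1]]] := chf_pow_error.
have [C2 [c2 [C20 c20 H2]]] := gauss_tail_error.
pose c := Num.min c1 c2; pose C := C1 + C2.
have c0 : 0 < c by rewrite lt_min c10.
(* The scalar form [2 * c] turns the common majorant of both error bounds into a summand of a
   Gaussian sum. *)
have [D pD qDE] : exists2 D : 'M[R]_n, posdef D & forall x, quad D x = 2 * c * sqn x.
  exists (2 * c)%:M; last by move=> x; rewrite quad_scalar.
  split=> [|x x0]; first by rewrite tr_scalar_mx.
  rewrite quad_scalar mulr_gt0 ?mulr_gt0// lt_def sqn_ge0 andbT.
  apply: contra_neq x0 => s0; apply/rowP => i; rewrite mxE.
  have := coord_le_sqn x i; rewrite s0 => xi; apply/eqP; rewrite -sqrf_eq0.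
  by rewrite eq_le xi sqr_ge0.
have [detA finA cvA] := gauss_sum_cvg (covmx_posdef R K0 sp).
have [_ finD cvD] := gauss_sum_cvg pD.
set g := Num.sqrt _ in cvA; set gD := Num.sqrt _ in cvD.
(* Since [2 * pi * sqrt t] is the mesh times [2 t + 1], this is the grid sum with weight
   [mesh t ^+ n] per point. *)
pose X t := (2 * pi * Num.sqrt t%:R) ^+ n * ((walk_count w t (m t))%:R / N ^+ t).
pose GA t := fine (gauss_sum (covmx R w) (mesh t)).
pose GD t := fine (gauss_sum D (mesh t)).
have pi0 := pi_gt0 R.
have key t : P t -> (2 <= t)%N -> gauss_sum (covmx R w) (mesh t) \is a fin_num ->
    gauss_sum D (mesh t) \is a fin_num -> `|X t - GA t| <= C / Num.sqrt t%:R * GD t.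
  move=> Pt t2 fA fD; set M := t.*2.+1.
  have M0 : 0 < M%:R :> R by rewrite ltr0n.
  have tM : (2 * t <= M)%N by rewrite mul2n leqnSn.
  have tM1 : (M < 2 * t.+1)%N by rewrite mul2n doubleS.
  have t0 : (0 < t)%N by exact: ltnW.
  have [h0 h2] := mesh_angle t.
  pose th (z : 'rV[int]_n) : 'rV[R]_n := (2 * pi / M%:R) *: map_mx intr z.
  have qA z : quad (covmx R w) (mesh t *: map_mx intr z) = t%:R * quad (covmx R w) (th z).
    by rewrite !quadZ h2 mulrA.
  have qD z : quad D (mesh t *: map_mx intr z) = 2 * (c * (t%:R * sqn (th z))).
    by rewrite quadZ h2 -mulrA -quadZ qDE; ring.
  have eps0 : 0 <= C / Num.sqrt (t%:R : R) by rewrite divr_ge0 ?sqrtr_ge0// addr_ge0// ltW.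
  have eps_le (C' c' : R) (z : 'rV[int]_n) : 0 < C' -> C' <= C -> c <= c' ->
      C' / Num.sqrt t%:R * expR (- (c' * (t%:R * sqn (th z)))) <=
      C / Num.sqrt t%:R * expR (- quad D (mesh t *: map_mx intr z) / 2).
    move=> C'0 C'C c'c; apply: ler_pM; rewrite ?expR_ge0 ?divr_ge0 ?sqrtr_ge0 ?(ltW C'0)//.
      by apply: ler_wpM2r => //; rewrite invr_ge0 sqrtr_ge0.
    rewrite ler_expR qD mulNr lerN2 mulrC mulKf// .
    by apply: ler_wpM2r => //; rewrite mulr_ge0// sqn_ge0.
  have hn0 : 0 <= mesh t ^+ n by rewrite exprn_ge0.
  have -> : X t = \sum_(f : {ffun 'I_n -> 'I_M})
      mesh t ^+ n * Re ((chf w (th (grid f)) / N%:C%C) ^+ t).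
    rewrite -mulr_sumr.
    have := walk_count_fourier (mE t Pt).
    under eq_bigr do rewrite -/(th _).
    rewrite -/M => Hf.
    have -> : \sum_(f : {ffun 'I_n -> 'I_M}) Re ((chf w (th (grid f)) / N%:C%C) ^+ t) =
        (walk_count w t (m t))%:R * M%:R ^+ n / N ^+ t.
      transitivity (Re (\sum_(f : {ffun 'I_n -> 'I_M}) (chf w (th (grid f)) / N%:C%C) ^+ t : R[i])).
        by elim/big_rec2: _ => [//|f x y _ ->]; rewrite raddfD.
      under eq_bigr do rewrite exprMn exprVn.
      rewrite -mulr_suml -Hf.
      rewrite -(rmorphXn (real_complex R)) -(rmorph_nat (real_complex R)) -(rmorph_nat (real_complex R) M).
      by rewrite -(rmorphXn (real_complex R)) -(rmorphM (real_complex R)) -(fmorphV (real_complex R)) -(rmorphM (real_complex R)).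
    rewrite /X.
    have -> : 2 * pi * Num.sqrt t%:R = mesh t * M%:R by rewrite divfK// gt_eqF.
    by rewrite exprMn; ring.
  rewrite /GA /GD /gauss_sum; rewrite /gauss_sum in fA fD.
  apply: (esum_sandwich (@grid_inj t) eps0 _ _ _ _ fA fD).
  - by move=> z; rewrite mulr_ge0 ?expR_ge0.
  - by move=> z; rewrite mulr_ge0 ?expR_ge0.
  - move=> f; rewrite -mulrBr normrM (ger0_norm hn0) mulrCA; apply: ler_wpM2l => //.
    rewrite qA; apply: (le_trans (H1 t (th (grid f)) t2 _)).
      move=> i; rewrite !mxE normrM ger0_norm; last by rewrite divr_ge0 ?mulr_ge0 ?(ltW pi0).
      rewrite mulrAC ler_pdivrMr// [2 * pi]mulrC -mulrA ler_pM2l// -intr_norm.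
      have := grid_coord f i; rewrite mxE -(ler_int R) => l.
      apply: (@le_trans _ _ (2 * t%:R)); first by rewrite ler_pM2l.
      by rewrite -natrM ler_nat.
    by apply: eps_le => //; rewrite ?lerDl ?(ltW C20)// ge_min lexx.
  - move=> z /notin_grid[i zi]; rewrite mulrCA; apply: ler_wpM2l => //.
    rewrite qA; apply: (le_trans (H2 t (th z) i t0 _)).
      rewrite !mxE normrM ger0_norm; last by rewrite divr_ge0 ?mulr_ge0 ?(ltW pi0).
      rewrite mulrAC ltr_pdivlMr// [2 * pi]mulrC -mulrA ltr_pM2l// -intr_norm.
      have : t%:Z + 1 <= `|z 0 i| by rewrite lezD1.
      rewrite -(ler_int R) intrD => l.
      apply: (@lt_le_trans _ _ (2 * (t%:R + 1))); last by rewrite ler_pM2l.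
      by rewrite natr1 -natrM ltr_nat.
    by apply: eps_le => //; rewrite ?lerDr ?(ltW C10)// ge_min lexx orbT.
have cvGA : GA t @[t --> within P \oo] --> g.
  by apply: cvg_within_filter; apply: (cvg_comp _ _ cvg_mesh cvA).
have cvGD : GD t @[t --> within P \oo] --> gD.
  by apply: cvg_within_filter; apply: (cvg_comp _ _ cvg_mesh cvD).
have cvE : C / Num.sqrt t%:R * GD t @[t --> within P \oo] --> 0.
  rewrite -(mul0r gD); apply: cvgM => //; rewrite -(mulr0 C); apply: cvgM; first exact: cvg_cst.
  by apply: cvg_within_filter; exact: cvg_sqrt_inv.
have mesh_near (Q : R -> Prop) : (\forall h \near 0^'+, Q h) -> \forall t \near \oo, Q (mesh t).
  by move=> H; exact: (cvg_mesh H).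
have near_fin : \forall t \near \oo, [/\ (2 <= t)%N,
    gauss_sum (covmx R w) (mesh t) \is a fin_num & gauss_sum D (mesh t) \is a fin_num].
  have nA := mesh_near _ finA; have nD := mesh_near _ finD.
  by apply: (filterS3 _ _ (nbhs_infty_ge 2) nA nD) => t t2 fA fD; split.
have near_key : \forall t \near within P \oo, `|X t - GA t| <= C / Num.sqrt t%:R * GD t.
  rewrite near_withinE; near=> t => Pt.
  have [t2 fA fD] : [/\ (2 <= t)%N, gauss_sum (covmx R w) (mesh t) \is a fin_num &
    gauss_sum D (mesh t) \is a fin_num] by near: t; exact: near_fin.
  exact: key Pt t2 fA fD.
have cvXG : (X t - GA t) @[t --> within P \oo] --> 0.
  apply: (@squeeze_cvgr _ _ _ _ (fun t => - (C / Num.sqrt t%:R * GD t)) (fun t => C / Num.sqrt t%:R * GD t)).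
  - by near do rewrite -ler_norml.
  - by rewrite -oppr0; apply: cvgN.
  - exact: cvE.
have cvX : X t @[t --> within P \oo] --> g.
  rewrite (_ : X = (fun t => (X t - GA t) + GA t)); last by apply/funext => t; rewrite subrK.
  by rewrite -[g]add0r; apply: cvgD.
(* The reciprocal of the limit [g]; it converts [X] into the quotient of the statement. *)
pose k := Num.sqrt (\det (covmx R w)) / Num.sqrt ((2 * pi) ^+ n).
have p0 : 0 < (2 * pi : R) ^+ n by rewrite exprn_gt0// mulr_gt0.
have sp0 : 0 < Num.sqrt ((2 * pi : R) ^+ n) by rewrite sqrtr_gt0.
have sd0 : 0 < Num.sqrt (\det (covmx R w)) by rewrite sqrtr_gt0.
have gk : g * k = 1.
  by rewrite /g /k sqrtrM ?(ltW p0)// sqrtrV ?(ltW detA)//; field; rewrite !gt_eqF.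
rewrite -[X in _ --> X]gk (_ : (fun t => _) = (fun t => X t * k)); last first.
  apply/funext => t; rewrite /X /k sqrtrM ?exprn_ge0 ?mulr_ge0 ?(ltW pi0)//.
  rewrite [(2 * pi * t%:R) ^+ n]exprMn sqrtrM ?(ltW p0)//.
  have -> : Num.sqrt (t%:R ^+ n : R) = Num.sqrt t%:R ^+ n.
    elim: (n) => [|q IH]; first by rewrite !expr0 sqrtr1.
    by rewrite !exprS sqrtrM ?IH.
  have e2 := sqr_sqrtr (ltW p0).
  rewrite [(2 * pi * Num.sqrt _) ^+ n]exprMn.
  set s1 := Num.sqrt ((2 * pi) ^+ n) in e2 sp0 *; rewrite -e2.
  set N' := N ^+ t; have N'0 : N' != 0 by rewrite expf_neq0// gt_eqF.
  by field; rewrite N'0 gt_eqF.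
by apply: cvgM => //; exact: cvg_cst.
Unshelve. all: by end_near. Qed.

End LocalLimit.

(** * The determinant of the covariance matrix *)

Section Determinants.
Variable R : numFieldType.

(** The Weinstein-Aronszajn identity, from two triangular factorisations of one block matrix. *)
Lemma det1D_mulmxC m p (U : 'M[R]_(m, p)) (V : 'M[R]_(p, m)) :
  \det (1%:M + U *m V) = \det (1%:M + V *m U).
Proof.
pose B := block_mx 1%:M (- U) V 1%:M.
have B1 : B = block_mx 1%:M 0 V 1%:M *m block_mx 1%:M (- U) 0 (1%:M + V *m U).
  rewrite mulmx_block !mul1mx !mulmx1 !mul0mx ?mulmx0 !addr0 mulmxN.
  by rewrite addrC addrK.
have B2 : B = block_mx (1%:M + U *m V) (- U) 0 1%:M *m block_mx 1%:M 0 V 1%:M.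
  rewrite mulmx_block !mul1mx !mulmx1 ?mul0mx ?mulmx0 ?add0r ?addr0 mulNmx.
  by rewrite addrK.
have := congr1 determinant B1; rewrite {1}B2 !det_mulmx !det_ublock !det_lblock !det1.
by rewrite !mul1r !mulr1.
Qed.

Lemma det1D_const_mx m (y : R) : \det (1%:M + y *: const_mx 1 : 'M[R]_m) = 1 + y * m%:R.
Proof.
have -> : y *: const_mx 1 = (const_mx y : 'cV[R]_m) *m (const_mx 1 : 'rV[R]_m).
  by apply/matrixP => i j; rewrite !mxE big_ord1 !mxE.
rewrite det1D_mulmxC {1}[_ *m _]mx11_scalar -raddfD /= det_scalar1 mxE; congr (1 + _).
by under eq_bigr do rewrite !mxE mul1r; rewrite sumr_const card_ord mulr_natr.
Qed.

(** Adding all rows to the first row and all columns to the first column, which is congruence by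
    [L], clears the first row and column of [A] and turns the corner of the all-ones matrix into
    [q ^+ 2]. *)
Lemma det_addD_zero_sums p (A : 'M[R]_(1 + p)) (s : R) :
  (forall i, \sum_j A i j = 0) -> (forall j, \sum_i A i j = 0) ->
  \det (A + s *: const_mx 1) = (1 + p)%:R ^+ 2 * s * \det (drsubmx A).
Proof.
move=> rowA colA; set q : R := (1 + p)%:R.
have q0 : q != 0 by rewrite pnatr_eq0.
set D := drsubmx A.
pose e : 'rV[R]_p := const_mx 1.
pose L : 'M[R]_(1 + p) := block_mx 1%:M e 0 1%:M.
have detL : \det L = 1 by rewrite det_ublock !det1 mulr1.
have oneE : const_mx 1 = block_mx 1%:M e e^T (e^T *m e) :> 'M[R]_(1 + p).
  rewrite -[LHS]submxK; congr block_mx; apply/matrixP => i j; rewrite !mxE ?big_ord1 ?mxE ?mulr1//.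
  by rewrite !ord1.
have rowE : A *m (row_mx 1%:M e)^T = 0.
  apply/matrixP => i j; rewrite !mxE -[RHS](rowA i); apply: eq_bigr => l _.
  rewrite !mxE; case: splitP => x _; rewrite !mxE ?mulr1// !ord1 eqxx mulr1//.
have colE : row_mx 1%:M e *m A = 0.
  apply/matrixP => i j; rewrite !mxE -[RHS](colA j); apply: eq_bigr => l _.
  rewrite !mxE; case: splitP => x _; rewrite !mxE ?mul1r// !ord1 eqxx mul1r//.
move: rowE colE; rewrite -(submxK A) -/D tr_row_mx mul_block_col mul_row_block.
rewrite trmx1 !mulmx1 !mul1mx.
set a := ulsubmx A; set b := ursubmx A; set c := dlsubmx A => rowE colE.
have [r1 r2] : a + b *m e^T = 0 /\ c + D *m e^T = 0.
  by apply: eq_col_mx; rewrite rowE col_mx0.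
have [c1 c2] : a + e *m c = 0 /\ b + e *m D = 0.
  by apply: eq_row_mx; rewrite colE row_mx0.
have ee : e *m e^T = (p%:R)%:M.
  rewrite [LHS]mx11_scalar mxE; congr _%:M.
  by under eq_bigr do rewrite !mxE mulr1; rewrite sumr_const card_ord.
have qE : q = 1 + p%:R by rewrite /q natrD.
(* The left unitriangular factor on the right-hand side eliminates the remaining first column,
   leaving exactly [D] in the lower block. *)
have LAL : L *m (block_mx a b c D + s *: const_mx 1) *m L^T =
    block_mx 1%:M 0 (q^-1 *: e^T) 1%:M *m block_mx (q ^+ 2 * s)%:M ((q * s) *: e) 0 D.
  rewrite oneE scale_block_mx add_block_mx /L tr_block_mx !mulmx_block !trmx1 trmx0.
  rewrite !mul1mx !mul0mx !mulmx1 !mulmx0 !add0r !addr0.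
  have top1 : a + s *: 1%:M + e *m (c + s *: e^T) = (q * s)%:M.
    rewrite mulmxDr addrACA c1 add0r -scalemxAr ee !scale_scalar_mx -raddfD /=.
    by congr _%:M; rewrite qE; ring.
  have top2 : b + s *: e + e *m (D + s *: (e^T *m e)) = (q * s) *: e.
    rewrite mulmxDr addrACA c2 add0r -scalemxAr mulmxA ee mul_scalar_mx scalerA -scalerDl qE.
    by congr (_ *: _); ring.
  rewrite top1 top2; congr block_mx.
  - rewrite -scalemxAl ee scale_scalar_mx -raddfD /= qE; congr _%:M; ring.
  - rewrite -scalemxAl mul_mx_scalar scalerA mulmxDl addrACA r2 add0r -scalemxAl -mulmxA ee mul_mx_scalar.
    rewrite scalerA -scalerDl; congr (_ *: _); rewrite qE; field.
    by rewrite -qE.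
  - rewrite -scalemxAl -scalemxAr scalerA [RHS]addrC; congr (_ + _ *: _).
    by field.
have := congr1 determinant LAL.
by rewrite !det_mulmx det_tr detL det_lblock det_ublock !det1 det_scalar1 !mul1r mulr1.
Qed.

End Determinants.

(** * Pairs of points and the minor of the Johnson projection *)

Section PairDeterminant.
Variables (R : numFieldType) (u p : nat) (pr : 'I_(1 + p) -> {set 'I_u}).
Hypotheses (pr_inj : injective pr) (pr_card : forall e, #|pr e| = 2%N).
Hypothesis pr_surj : forall s : {set 'I_u}, #|s| = 2%N -> exists e, pr e = s.
Hypothesis u3 : (2 < u)%N.

Definition incmx : 'M[R]_(u, 1 + p) := \matrix_(i, e) (i \in pr e)%:R.

Lemma incmx_col e : \sum_i incmx i e = 2.
Proof.
rewrite -[2]/(2%:R) -(pr_card e) -sum1_card natr_sum [RHS]big_mkcond /=.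
by apply: eq_bigr => i _; rewrite mxE; case: (_ \in _).
Qed.

Lemma incmxTinc e f : (incmx^T *m incmx) e f = #|pr e :&: pr f|%:R.
Proof.
rewrite mxE -sum1_card natr_sum [RHS]big_mkcond /=.
by apply: eq_bigr => i _; rewrite !mxE inE -natrM mulnb; case: (_ && _).
Qed.

Lemma inc_pair i j : i != j -> \sum_e incmx i e * incmx j e = 1.
Proof.
move=> ij; have [e0 e0E] : exists e, pr e = [set i; j]%SET.
  by apply: pr_surj; rewrite cards2 ij.
rewrite (bigD1 e0)//= !mxE e0E !inE !eqxx orbT mulr1 big1 ?addr0// => e ne.
rewrite !mxE -natrM mulnb; case: andP => //= -[ie je]; case/negP: ne; apply/eqP/pr_inj.
rewrite e0E; apply/esym/eqP; rewrite eqEcard pr_card cards2 ij andbT.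
by apply/fintype.subsetP => x; rewrite !inE => /orP[] /eqP ->.
Qed.

Lemma inc_deg i : \sum_e incmx i e = (u.-1)%:R.
Proof.
have sq e : incmx i e * incmx i e = incmx i e by rewrite !mxE -natrM mulnb andbb.
(* Incidences on the pairs through [i] are counted twice: each pair has two points, and each of the
   other [u - 1] points lies on exactly one of them. *)
have : \sum_e incmx i e * \sum_j incmx j e = \sum_e incmx i e * 2.
  by apply: eq_bigr => e _; rewrite incmx_col.
under eq_bigr do rewrite mulr_sumr.
rewrite exchange_big /= (bigD1 i)//=.
under eq_bigr do rewrite sq.
have -> : \sum_(j | j != i) \sum_e incmx i e * incmx j e = \sum_(j | j != i) 1.
  by apply: eq_bigr => j ji; rewrite inc_pair// eq_sym.
rewrite -mulr_suml sumr_const cardC1 card_ord.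
by rewrite mulr_natr mulr2n => /addrI.
Qed.

Lemma incmxincT : incmx *m incmx^T = (u%:R - 2)%:M + const_mx 1.
Proof.
apply/matrixP => i j; rewrite !mxE.
have -> : \sum_e incmx i e * incmx^T e j = \sum_e incmx i e * incmx j e.
  by apply: eq_bigr => e _; rewrite [_^T _ _]mxE.
have [<-|ij] := eqVneq i j; last by rewrite inc_pair// mulr0n add0r.
transitivity (\sum_e incmx i e); first by apply: eq_bigr => e _; rewrite !mxE -natrM mulnb andbb.
rewrite inc_deg mulr1n -[in RHS](prednK (ltnW (ltnW u3))) -natr1; ring.
Qed.

(* The matrix [1 - N^T N / (u - 1) + 2 J / (u (u - 1))] is the orthogonal projection
   onto the eigenspace of dimension [p] of the Johnson scheme on the pairs of points. *)
Definition johnson_proj : 'M[R]_(1 + p) :=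
  1%:M - (u%:R - 1)^-1 *: (incmx^T *m incmx) + (2 / (u%:R * (u%:R - 1))) *: const_mx 1.

Lemma num_pairs : (1 + p)%:R * 2 = u%:R * (u%:R - 1) :> R.
Proof.
have : \sum_e \sum_i incmx i e = \sum_(e < 1 + p) 2 by apply: eq_bigr => e _; exact: incmx_col.
rewrite sumr_const card_ord mulr_natl => <-.
rewrite exchange_big /=; under eq_bigr do rewrite inc_deg.
rewrite sumr_const card_ord mulr_natl; congr (_ *+ _).
by rewrite -[in RHS](prednK (ltnW (ltnW u3))) -natr1; ring.
Qed.

Let u10 : u%:R - 1 != 0 :> R.
Proof. by rewrite subr_eq0 pnatr_eq1; apply/eqP => ue; move: u3; rewrite ue. Qed.
Let u0 : u%:R != 0 :> R. Proof. by rewrite pnatr_eq0 -lt0n; lia. Qed.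

Lemma johnson_proj_sym : johnson_proj^T = johnson_proj.
Proof.
rewrite /johnson_proj linearD /= linearB /= trmx1 !linearZ /= trmx_mul trmxK.
by congr (_ + _ *: _); apply/matrixP => i j; rewrite !mxE.
Qed.

Lemma johnson_proj_row e : \sum_f johnson_proj e f = 0.
Proof.
have -> : \sum_f johnson_proj e f = \sum_f (1%:M e f) - (u%:R - 1)^-1 * \sum_f (incmx^T *m incmx) e f
    + (2 / (u%:R * (u%:R - 1))) * (1 + p)%:R.
  have cE (c : R) : c * (1 + p)%:R = \sum_(f < 1 + p) c by rewrite sumr_const card_ord mulr_natr.
  rewrite mulr_sumr -sumrB cE -big_split /=.
  by apply: eq_bigr => f _; rewrite /johnson_proj; move: (incmx^T *m incmx) => T; rewrite !mxE mulr1.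
have -> : \sum_f (1%:M e f) = 1 :> R.
  rewrite (bigD1 e)//= mxE eqxx big1 ?addr0// => f fe; by rewrite mxE eq_sym (negPf fe).
have -> : \sum_f (incmx^T *m incmx) e f = 2 * (u%:R - 1).
  under eq_bigr do rewrite mxE.
  rewrite exchange_big /= -[2](incmx_col e) mulr_suml; apply: eq_bigr => i _.
  rewrite -mulr_sumr inc_deg mxE; congr (_ * _).
  by rewrite -[in RHS](prednK (ltnW (ltnW u3))) -natr1; ring.
have : (1 + p)%:R = u%:R * (u%:R - 1) / 2 :> R by rewrite -num_pairs; field.
by move=> ->; field; rewrite u10 u0.
Qed.

(** All rows and columns sum to zero, so the minor is read off after subtracting the all-ones term.
    What remains is 1 minus a multiple of [incmx^T *m incmx], and exchanging the factors brings it
    to size [u], where it is a multiple of 1 minus the all-ones matrix. *)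
Lemma det_johnson_minor :
  \det (drsubmx johnson_proj) = 2 / (u%:R * (u%:R - 1) ^+ u).
Proof.
set c : R := 2 / (u%:R * (u%:R - 1)).
have c0 : c != 0 by rewrite mulf_neq0// invr_neq0// mulf_neq0.
have colz j : \sum_i johnson_proj i j = 0.
  by rewrite -[RHS](johnson_proj_row j); apply: eq_bigr => i _; rewrite -{1}johnson_proj_sym mxE.
have := det_addD_zero_sums (- c) johnson_proj_row colz.
have -> : johnson_proj + - c *: const_mx 1 = 1%:M + (- (u%:R - 1)^-1 *: incmx^T) *m incmx.
  by rewrite /johnson_proj -/c scaleNr addrK -scalemxAl scaleNr.
rewrite det1D_mulmxC -scalemxAr incmxincT.
have -> : 1%:M + - (u%:R - 1)^-1 *: ((u%:R - 2)%:M + const_mx 1) =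
   (u%:R - 1)^-1 *: (1%:M + (-1) *: const_mx 1) :> 'M[R]_u.
  apply/matrixP => i j; rewrite !mxE; case: (i == j); rewrite ?mulr1n ?mulr0n; by field.
rewrite detZ det1D_const_mx => h.
have q2 : (1 + p)%:R = u%:R * (u%:R - 1) / 2 :> R by rewrite -num_pairs; field.
rewrite q2 in h.
have uX : (u%:R - 1 : R) ^+ u != 0 by rewrite expf_neq0.
have h2 : (u%:R - 1)^-1 ^+ u * (1 + -1 * u%:R) = - (u%:R * (u%:R - 1) / 2 * \det (drsubmx johnson_proj)).
  by rewrite h /c; field; rewrite u10 u0.
have -> : \det (drsubmx johnson_proj) = (u%:R * (u%:R - 1) / 2)^-1 * - - (u%:R * (u%:R - 1) / 2 * \det (drsubmx johnson_proj)).
  by field; rewrite u10 u0.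
rewrite -h2 exprVn; field; by rewrite uX u10 u0.
Qed.

End PairDeterminant.

Local Close Scope classical_set_scope.

(** * Counting subsets *)

Lemma card_supersets (T : finType) (J : {set T}) (k : nat) : (#|J| <= k)%N ->
  #|[pred S : {set T} | (J \subset S) && (#|S| == k)]| = 'C(#|T| - #|J|, k - #|J|).
Proof.
move=> Jk; have <- : #|~: J| = (#|T| - #|J|)%N by rewrite [LHS]cardsCs finset.setCK.
rewrite -cards_draws; set A := (X in _ = #|X|).
have disj B : B \in A -> [disjoint J & B].
  by rewrite inE => /andP[BJ _]; rewrite disjoint_sym finset.disjoints_subset.
rewrite -(@card_in_imset _ _ (fun B : {set T} => J :|: B) A); last first.
  move=> B C /disj dB /disj dC /(congr1 (fun X => X :\: J)).
  rewrite !finset.setDUl !finset.setDv !finset.set0U.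
  by rewrite !(finset.setDidPl _)// disjoint_sym.
apply: eq_card => S; rewrite inE; apply/andP/imsetP => [[JS /eqP Sk]|[B BA ->]].
  exists (S :\: J); last by rewrite finset.setDE finset.setUIr finset.setUCr finset.setIT; apply/esym/finset.setUidPr.
  by rewrite inE finset.subsetDr cardsDS// Sk eqxx.
split; first exact: finset.subsetUl.
rewrite cardsU finset.disjoint_setI0 ?disj// cards0 subn0.
by move: BA; rewrite inE => /andP[_ /eqP ->]; rewrite subnKC.
Qed.

Lemma natr_ffact (R : pzRingType) (n j : nat) :
  (n ^_ j)%:R = \prod_(i < j) (n%:R - i%:R) :> R.
Proof.
elim: j => [|j IH]; first by rewrite big_ord0.
rewrite big_ord_recr /= -IH ffactnSr natrM.
have [jn|nj] := leqP j n; first by rewrite natrB.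
by rewrite ffact_small// !mul0r.
Qed.

Lemma bin_sub_ffact (v k j : nat) : (j <= k)%N -> (k <= v)%N ->
  ('C(v - j, k - j) * v ^_ j = 'C(v, k) * k ^_ j)%N.
Proof.
move=> jk kv; elim: j jk => [|j IH] jk; first by rewrite !subn0.
rewrite !ffactnSr [RHS]mulnA -IH ?(ltnW jk)//.
have := mul_bin_diag (v - j) (k - j.+1).
have -> : ((k - j.+1).+1 = k - j)%N by rewrite subnSK.
have -> : ((v - j).-1 = v - j.+1)%N by rewrite subnS.
by move=> h; rewrite mulnCA [('C(_, _) * (v - j))%N]mulnC h mulnCA mulnC [(v ^_ j * _)%N]mulnC.
Qed.

Lemma ex_subset_card (T : finType) (B : {set T}) (m : nat) : (m <= #|B|)%N ->
  exists2 A : {set T}, A \subset B & #|A| = m.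
Proof.
move=> mB; have : (0 < 'C(#|B|, m))%N by rewrite bin_gt0.
rewrite -cards_draws => /card_gt0P[A]; rewrite inE => /andP[AB /eqP Am].
by exists A.
Qed.

(** * Covariance of the coordinates of a random block *)

Section Blocks.
Variables (R : realType) (u k p : nat) (pr : 'I_(1 + p) -> {set 'I_u}).
Hypotheses (pr_inj : injective pr) (pr_card : forall e, #|pr e| = 2%N).
Hypothesis pr_surj : forall s : {set 'I_u}, #|s| = 2%N -> exists e, pr e = s.
Hypotheses (k2 : (2 <= k)%N) (ku : (k < u)%N).

Let u3 : (2 < u)%N. Proof. exact: leq_ltn_trans ku. Qed.

Definition block : finType := {S : {set 'I_u.+1} | #|S| == k}.

(** The singled-out point is [ord0]; [emb] lists the others. *)
Definition emb : 'I_u -> 'I_u.+1 := lift ord0.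

Lemma emb_inj : injective emb. Proof. exact: lift_inj. Qed.

(* The coordinate indexed by [x] of a block is 1 iff the block contains [supp x]:
   a single point other than [ord0], or a pair of such points other than [pr ord0]. *)
Definition supp (x : 'I_(u + p)) : {set 'I_u.+1} :=
  match fintype.split x with
  | inl i => [set emb i]%SET
  | inr j => emb @: pr (rshift 1 j)
  end.

Definition coord (S : block) (x : 'I_(u + p)) : bool := supp x \subset val S.

Lemma card_block : #|block| = 'C(u.+1, k).
Proof. by rewrite card_sig -[in RHS](card_ord u.+1) -card_draws cardsE. Qed.

Lemma card_block_gt0 : (0 < #|block|)%N.
Proof. by rewrite card_block bin_gt0; apply: leqW; exact: ltnW. Qed.

(** The probability that a uniform block contains [j] given points. *)
Definition incl_prob (j : nat) : R := (k ^_ j)%:R / (u.+1 ^_ j)%:R.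

Lemma sum_incl (J : {set 'I_u.+1}) :
  (\sum_(S : block) (J \subset val S)%:R) / #|block|%:R = incl_prob #|J| :> R.
Proof.
have sumE : \sum_(S : block) (J \subset val S)%:R =
    #|[pred S : {set 'I_u.+1} | (J \subset S) && (#|S| == k)]|%:R :> R.
  rewrite -(big_sub (fun S : {set 'I_u.+1} => #|S| == k) (fun S => (J \subset S)%:R)).
  rewrite -sum1_card natr_sum big_mkcond [RHS]big_mkcond /=; apply: eq_bigr => S _.
  by rewrite !inE unfold_in; case: (_ \subset _); case: (_ == _).
rewrite sumE /incl_prob card_block.
have kv : (k <= u.+1)%N by apply: leqW; exact: ltnW.
have C0 : 'C(u.+1, k)%:R != 0 :> R by rewrite pnatr_eq0 -lt0n bin_gt0.
have F0 : (u.+1 ^_ #|J|)%:R != 0 :> R.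
  by rewrite pnatr_eq0 -lt0n ffact_gt0 -[X in (_ <= X)%N]card_ord max_card.
have [Jk|kJ] := leqP #|J| k.
  rewrite card_supersets// card_ord; apply/eqP; rewrite eqr_div// -!natrM.
  by rewrite bin_sub_ffact// mulnC.
rewrite ffact_small// mul0r (_ : #|_| = 0%N) ?mul0r//.
apply: eq_card0 => S; rewrite !inE; apply/negP => /andP[/subset_leq_card JS /eqP Sk].
by move: JS; rewrite Sk leqNgt kJ.
Qed.

Lemma mean_coord x : mean R coord x = incl_prob #|supp x|.
Proof. exact: sum_incl. Qed.

(** The product of two inclusion indicators is the indicator for the union of the supports. *)
Lemma covmx_coord x y :
  covmx R coord x y = incl_prob #|supp x :|: supp y| - incl_prob #|supp x| * incl_prob #|supp y|.
Proof.
have N0 : #|block|%:R != 0 :> R by rewrite pnatr_eq0 -lt0n card_block_gt0.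
rewrite mxE -!mean_coord -sum_incl.
have -> : \sum_S dev R coord S x * dev R coord S y =
    \sum_(S : block) (supp x :|: supp y \subset val S)%:R - mean R coord x * \sum_S (coord S y)%:R
     - mean R coord y * \sum_S dev R coord S x.
  rewrite !mulr_sumr -!sumrB; apply: eq_bigr => S _.
  by rewrite /dev finset.subUset -/(coord S x) -/(coord S y) -mulnb natrM; ring.
rewrite dev_sum ?card_block_gt0// mulr0 subr0 mulrBl -mulrA.
by congr (_ - _ * _).
Qed.

Let v : R := u.+1%:R.
Let kr : R := k%:R.

Lemma incl_probE j : incl_prob j = \prod_(i < j) ((kr - i%:R) / (v - i%:R)).
Proof. by rewrite /incl_prob !natr_ffact prodf_div. Qed.

Let vj0 (j : nat) : (j <= u)%N -> v - j%:R != 0.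
Proof. by move=> ju; rewrite subr_eq0 eqr_nat; lia. Qed.

Let v0 : v != 0. Proof. by rewrite pnatr_eq0. Qed.
Let v1 : v - 1 != 0. Proof. by apply: (@vj0 1); lia. Qed.
Let v2 : v - 2 != 0. Proof. by apply: (@vj0 2); lia. Qed.
Let v3 : v - 3 != 0. Proof. by apply: (@vj0 3); lia. Qed.

Let v11 : v - 1 - 1 != 0. Proof. by rewrite -addrA -opprD. Qed.

Local Ltac vfield :=
  move: v0 v1 v2 v3 v11; move: (v) (kr) => V K V0 V1 V2 V3 V11;
  field; repeat (apply/andP; split); assumption.

Let prE := (incl_probE, big_ord_recr, big_ord0, subr0, mul1r).

(** [alpha] scales the covariance [X] of the points, [gamma] is the regression coefficient of a pair
    on each of its two points, and [mu] scales the covariance of the residues. *)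
Let alpha : R := kr * (v - kr) / (v * (v - 1)).
Let gamma : R := (kr - 1) / (v - 2).
Let mu : R := kr * (kr - 1) * (v - kr) * (v - kr - 1) / (v * (v - 1) * (v - 2) * (v - 3)).

Let X : 'M[R]_u := alpha *: (1%:M - v^-1 *: const_mx 1).
Let N := incmx R pr.
Let N' : 'M[R]_(u, p) := rsubmx N.

Lemma mulX q (A : 'M[R]_(u, q)) i j : (X *m A) i j = alpha * (A i j - v^-1 * \sum_l A l j).
Proof.
rewrite -scalemxAl mulmxBl mul1mx -scalemxAl !mxE; congr (_ * (_ - _ * _)).
by apply: eq_bigr => l _; rewrite mxE mul1r.
Qed.

Lemma supp_lshift i : supp (lshift p i) = [set emb i]%SET.
Proof. by rewrite /supp (unsplitK (inl i)). Qed.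

Lemma supp_rshift j : supp (rshift u j) = emb @: pr (rshift 1 j).
Proof. by rewrite /supp (unsplitK (inr j)). Qed.

(** Every entry depends only on how the two supports meet, so each block reduces to a few rational
    identities in [v] and [k]. *)
Lemma covmx_block : covmx R coord =
  block_mx X (gamma *: (X *m N')) (gamma *: (N'^T *m X))
    (gamma ^+ 2 *: (N'^T *m (X *m N')) + mu *: drsubmx (johnson_proj R pr)).
Proof.
have XT : X^T = X.
  by rewrite /X linearZ linearB /= trmx1 linearZ /=; congr (_ *: (_ - _ *: _)); apply/matrixP => i j; rewrite !mxE.
have N'E i j : N' i j = (i \in pr (rshift 1 j))%:R by rewrite !mxE.
have N'sum j : \sum_l N' l j = 2.
  by rewrite -(incmx_col R pr_card (rshift 1 j)); apply: eq_bigr => l _; rewrite mxE.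
have upper i j : covmx R coord (lshift p i) (rshift u j) = (gamma *: (X *m N')) i j.
  rewrite covmx_coord supp_lshift supp_rshift cards1 card_imset ?pr_card//; last exact: emb_inj.
  rewrite mxE mulX N'sum N'E cardsU1 card_imset ?pr_card//; last exact: emb_inj.
  rewrite mem_imset; last exact: emb_inj.
  case: (i \in _) => /=; rewrite ?add0n ?add1n !prE /= /alpha /gamma; vfield.
apply/matrixP => x y; rewrite -[x]splitK -[y]splitK.
case: (fintype.split x) => [i|j]; case: (fintype.split y) => [i'|j'] /=.
- rewrite block_mxEul covmx_coord !supp_lshift !cards1 cards2 (inj_eq emb_inj) !mxE.
  case: (i == i') => /=; rewrite ?mulr1n ?mulr0n !prE /= /alpha; vfield.
- by rewrite block_mxEur upper.
- rewrite block_mxEdl -[N'^T *m X]trmxK trmx_mul trmxK XT -linearZ /= [in RHS]mxE -upper.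
  by rewrite !covmx_coord finset.setUC mulrC.
rewrite block_mxEdr covmx_coord !supp_rshift -imsetU !card_imset; [|exact: emb_inj..].
rewrite cardsU !pr_card.
set r := #|pr (rshift 1 j) :&: pr (rshift 1 j')|.
have JE : drsubmx (johnson_proj R pr) j j' = (j == j')%:R - (u%:R - 1)^-1 * r%:R + 2 / (u%:R * (u%:R - 1)).
  rewrite /r -incmxTinc /johnson_proj; move: (_ *m _) => T; rewrite !mxE mulr1.
  by rewrite (inj_eq (@rshift_inj 1 p)).
have QE : (N'^T *m (X *m N')) j j' = alpha * (r%:R - 4 / v).
  have e1 l : N'^T j l * (X *m N') l j' = alpha * (N' l j * N' l j' - 2 / v * N' l j).
    by rewrite mulX N'sum [N'^T j l]mxE; ring.
  rewrite mxE (eq_bigr _ (fun l _ => e1 l)) -mulr_sumr sumrB -mulr_sumr N'sum.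
  have -> : \sum_l N' l j * N' l j' = r%:R.
    by rewrite /r -incmxTinc mxE; apply: eq_bigr => l _; rewrite !mxE.
  by vfield.
rewrite [RHS]mxE [X in _ = X + _]mxE [X in _ = _ + X]mxE QE JE.
have uE : u%:R = v - 1 :> R by rewrite /v -natr1 addrK.
have rj : r = (if j == j' then 2 else r)%N.
  by case: eqP => [jj|//]; rewrite /r jj finset.setIid pr_card.
have r1 : j != j' -> (r <= 1)%N.
  move=> jj; rewrite leqNgt; apply/negP => r2; case/negP: jj.
  rewrite -(inj_eq (@rshift_inj 1 p)) -(inj_eq pr_inj).
  have /eqP <- : pr (rshift 1 j) :&: pr (rshift 1 j') == pr (rshift 1 j).
    by rewrite eqEcard finset.subsetIl pr_card.
  by rewrite eqEcard finset.subsetIr pr_card.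
(* Equal pairs share two points and distinct ones at most one, so the cases [r = 2], 1 and 0
   remain. *)
rewrite uE; have [jj|jj] := eqVneq j j'.
  rewrite rj jj eqxx !prE /= /alpha /gamma /mu; vfield.
move: (r1 jj); rewrite leq_eqVlt => /orP[/eqP ->|].
  rewrite !prE /= /alpha /gamma /mu; vfield.
rewrite ltnS leqn0 => /eqP ->.
rewrite !prE /= /alpha /gamma /mu; vfield.
Qed.

(** The unitriangular factor carries the regression of the pairs on the points. The determinant is
    then that of [X] times that of the residual block. *)
Lemma det_covmx_coord : \det (covmx R coord) =
  2 * mu ^+ p * (alpha / (v - 2)) ^+ u / (v * (v - 1)).
Proof.
have -> : covmx R coord = block_mx 1%:M 0 (gamma *: N'^T) 1%:M *m
    block_mx X (gamma *: (X *m N')) 0 (mu *: drsubmx (johnson_proj R pr)).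
  rewrite covmx_block mulmx_block !mul1mx !mul0mx ?mulmx0 !addr0.
  congr block_mx; first by rewrite -scalemxAl.
  by rewrite -scalemxAl -scalemxAr scalerA expr2.
rewrite det_mulmx det_lblock det_ublock !det1 !mul1r !detZ.
rewrite (det_johnson_minor R pr_inj pr_card pr_surj u3) -scaleNr det1D_const_mx.
have uE : u%:R = v - 1 :> R by rewrite /v -natr1 addrK.
have w2 : (v - 2) ^+ u != 0 by rewrite expf_neq0.
rewrite uE -addrA -opprD [(alpha / _) ^+ u]exprMn exprVn.
have -> : v - (1 + 1) = v - 2 by [].
move: v0 v1 w2; move: (v) => V V0 V1 W2.
by field; rewrite V0 V1 W2.
Qed.

Lemma bin_pairs : 'C(u, 2) = p.+1.
Proof.
have /eqP := num_pairs R pr_inj pr_card pr_surj u3.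
have -> : u%:R - 1 = u.-1%:R :> R by rewrite -[in LHS](prednK (ltnW (ltnW u3))) -natr1 addrK.
rewrite -!natrM eqr_nat => /eqP h; rewrite bin2 -h mulnC mul2n doubleK//.
Qed.

Lemma det_covmx_bibd : \det (covmx R coord) = bibd_f R u.+1 k.
Proof.
rewrite det_covmx_coord /bibd_f binS bin1 bin_pairs.
(* With [v = u + 1] and [d = p + 1 + u], the exponents [d - v], [d - 1] and [d] become [p], [p + u]
   and [p + u + 1]. *)
have -> : (p.+1 + u - u.+1 = p)%N by lia.
have -> : (p.+1 + u - 1 = p + u)%N by lia.
have -> : (p.+1 + u = p + u + 1)%N by lia.
rewrite -/v -/kr !exprD expr1.
have muE : mu = (kr - 1) * (v - kr - 1) / (v - 3) * (kr * (v - kr) / (v - 2)) * (1 / (v * (v - 1))).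
  by rewrite /mu; vfield.
have alE : alpha / (v - 2) = kr * (v - kr) / (v - 2) * (1 / (v * (v - 1))).
  by rewrite /alpha; vfield.
rewrite muE alE.
set A := (kr - 1) * _ / _; set B := kr * _ / _; set C := 1 / _.
have -> : (A * B * C) ^+ p = A ^+ p * B ^+ p * C ^+ p by rewrite !exprMn.
have -> : (B * C) ^+ u = B ^+ u * C ^+ u by rewrite !exprMn.
by rewrite -[in LHS]div1r -/C; ring.
Qed.

End Blocks.

Lemma eq_set2 (T : finType) (a b c d : T) : a != b -> c != d ->
  ([set a; b]%SET == [set c; d]%SET) = ((a == c) && (b == d)) || ((a == d) && (b == c)).
Proof.
move=> ab cd; apply/eqP/idP => [E|].
  have : a \in [set c; d]%SET by rewrite -E !inE eqxx.
  have : b \in [set c; d]%SET by rewrite -E !inE eqxx orbT.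
  rewrite !inE => /orP[] /eqP bE /orP[] /eqP aE; move: ab; rewrite aE bE ?eqxx//= ?orbT//.
by move=> /orP[] /andP[/eqP -> /eqP ->] //; rewrite finset.setUC.
Qed.

(** * The differences of blocks generate the lattice *)

Section Spanning.
Variables (u k p : nat) (pr : 'I_(1 + p) -> {set 'I_u}).
Hypotheses (pr_inj : injective pr) (pr_card : forall e, #|pr e| = 2%N).
Hypotheses (k2 : (2 <= k)%N) (ku : (k < u)%N).

Let vec (S : block u k) : 'rV[int]_(u + p) := \row_x (coord pr S x)%:Z.

Definition zspan (g : 'rV[int]_(u + p)) := exists c : block u k -> int,
  \sum_S c S = 0 /\ g = \sum_S c S *: vec S.

Lemma zspan0 : zspan 0.
Proof. by exists (fun=> 0); split; rewrite big1// => S _; rewrite scale0r. Qed.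

Lemma zspanP a g h : zspan g -> zspan h -> zspan (a *: g + h).
Proof.
move=> [c [c0 ->]] [d [d0 ->]]; exists (fun S => a * c S + d S); split.
  by rewrite big_split /= -mulr_sumr c0 d0 mulr0.
by rewrite scaler_sumr -big_split /=; apply: eq_bigr => S _; rewrite scalerDl scalerA.
Qed.

Lemma zspanD g h : zspan g -> zspan h -> zspan (g + h).
Proof. by move=> sg sh; have := zspanP 1 sg sh; rewrite scale1r. Qed.

Lemma zspanB g h : zspan g -> zspan h -> zspan (g - h).
Proof. by move=> sg sh; have := zspanP (-1) sh sg; rewrite scaleN1r addrC. Qed.

Lemma zspan_diff S T : zspan (vec S - vec T).
Proof.
have pick1 (S0 : block u k) (F : block u k -> 'rV[int]_(u + p)) :
    \sum_S ((S == S0)%:Z) *: F S = F S0.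
  rewrite (bigD1 S0)//= eqxx scale1r big1 ?addr0// => S' /negPf ->; exact: scale0r.
have one (S0 : block u k) : \sum_S ((S == S0)%:Z) = 1.
  by rewrite (bigD1 S0)//= eqxx big1 ?addr0// => S' /negPf ->.
exists (fun S' => (S' == S)%:Z - (S' == T)%:Z); split; first by rewrite sumrB -(subrr 1); congr (_ - _); exact: one.
rewrite (eq_bigr (fun S' => (S' == S)%:Z *: vec S' - (S' == T)%:Z *: vec S')).
  by rewrite sumrB; congr (_ - _); exact/esym/pick1.
by move=> S' _; rewrite scalerBl.
Qed.

Lemma block_of (A : {set 'I_u.+1}) : #|A| = k -> exists S : block u k, val S = A.
Proof. by move=> Ak; exists (exist _ A (introT eqP Ak)). Qed.

Lemma vec_lshift S l : vec S 0 (lshift p l) = (emb l \in val S)%:Z.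
Proof. by rewrite mxE /coord supp_lshift finset.sub1set. Qed.

Lemma vec_rshift S j a b : pr (rshift 1 j) = [set a; b]%SET ->
  vec S 0 (rshift u j) = ((emb a \in val S) && (emb b \in val S))%:Z.
Proof.
by move=> E; rewrite mxE /coord supp_rshift E imsetU !imset_set1 finset.subUset !finset.sub1set.
Qed.

Let subE (g h : 'rV[int]_(u + p)) x : (g - h) 0 x = g 0 x - h 0 x.
Proof. by rewrite !mxE. Qed.

(** The unit vector at the pair [s], but 0 at the omitted pair [pr ord0], which has no
    coordinate. *)
Definition pair_unit (s : {set 'I_u}) : 'rV[int]_(u + p) :=
  row_mx 0 (\row_j (pr (rshift 1 j) == s)%:Z).

Lemma emb_neq0 (l : 'I_u) : (emb l == ord0) = false.
Proof. by rewrite eq_sym; apply/negbTE; exact: neq_lift. Qed.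

(** Take [k - 2] further points [B] and the four blocks adding to [B] one of [i], [j] and one of
    [a], [ord0]. In the alternating sum all points and all pairs meeting [B] cancel, and pairs with
    [ord0] have no coordinate. *)
Lemma zspan_pair_diff (i j a : 'I_u) : i != j -> i != a -> j != a ->
  zspan (pair_unit [set i; a]%SET - pair_unit [set j; a]%SET).
Proof.
move=> ij ia ja.
pose F : {set 'I_u.+1} := [set ord0; emb i; emb j; emb a]%SET.
have F4 : (#|F| <= 4)%N.
  apply: (leq_trans (leq_card_setU _ _)); rewrite cards1 addn1 ltnS.
  apply: (leq_trans (leq_card_setU _ _)); rewrite cards1 addn1 ltnS.
  by apply: (leq_trans (leq_card_setU _ _)); rewrite !cards1.
(* At least [u - 3] points lie outside [F], and [k < u] leaves room for [k - 2]. *)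
have [|B BF Bk] := @ex_subset_card _ (~: F) (k - 2).
  have := cardsC F; rewrite card_ord; lia.
have nB x : x \in F -> x \in B = false.
  by move=> xF; apply/negP => /(fintype.subsetP BF); rewrite inE xF.
have B0 : ord0 \in B = false by apply: nB; rewrite !inE eqxx.
have Bi : emb i \in B = false by apply: nB; rewrite !inE eqxx !orbT.
have Bj : emb j \in B = false by apply: nB; rewrite !inE eqxx !orbT.
have Ba : emb a \in B = false by apply: nB; rewrite !inE eqxx !orbT.
have mk x y : x != y -> x \in B = false -> y \in B = false ->
    exists S : block u k, val S = x |: (y |: B).
  move=> xy xB yB; apply: block_of; rewrite !cardsU1 !inE xB yB (negPf xy) /= Bk addnA.
  exact: subnKC.
have embE (x y : 'I_u) : (emb x == emb y) = (x == y) by rewrite (inj_eq (@emb_inj u)).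
have [S1 E1] := mk (emb i) (emb a) ltac:(by rewrite embE) Bi Ba.
have [S2 E2] := mk (emb i) ord0 ltac:(by rewrite emb_neq0) Bi B0.
have [S3 E3] := mk (emb j) (emb a) ltac:(by rewrite embE) Bj Ba.
have [S4 E4] := mk (emb j) ord0 ltac:(by rewrite emb_neq0) Bj B0.
suff -> : pair_unit [set i; a]%SET - pair_unit [set j; a]%SET = (vec S1 - vec S2) - (vec S3 - vec S4).
  by apply: zspanB; exact: zspan_diff.
have excl (l : 'I_u) : [&& ~~ ((l == i) && (l == j)), ~~ ((l == i) && (l == a)),
    ~~ ((l == j) && (l == a)) & (emb l \in B) ==> [&& l != i, l != j & l != a]].
  have [->|li] := eqVneq l i; first by rewrite (negPf ij) (negPf ia) Bi.
  have [->|lj] := eqVneq l j; first by rewrite (negPf ja) Bj.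
  by have [->|la] := eqVneq l a; rewrite ?Ba//= implybT.
apply/rowP => x; rewrite -[x]splitK; case: (fintype.split x) => [l|e] /=.
  rewrite !subE !vec_lshift E1 E2 E3 E4 !inE !embE emb_neq0 !row_mxEl !mxE subrr.
  by move: (excl l); case: (l == i); case: (l == j); case: (l == a); case: (emb l \in B).
have /eqP/cards2P[l [l' [ll' El]]] := pr_card (rshift 1 e).
rewrite !subE !(vec_rshift _ El) E1 E2 E3 E4 !inE !embE !emb_neq0 !row_mxEr !mxE El !eq_set2//.
have d z : ~~ ((l == z) && (l' == z)).
  by apply/negP => /andP[/eqP lx /eqP l'x]; move: ll'; rewrite lx l'x eqxx.
move: (excl l) (excl l') (d i) (d j) (d a).
by case: (l == i); case: (l == j); case: (l == a); case: (emb l \in B) => //;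
  case: (l' == i); case: (l' == j); case: (l' == a); case: (emb l' \in B).
Qed.

(** The omitted pair has vector 0, and any pair is reached from it by exchanging one point at a
    time. *)
Lemma zspan_pair (x y : 'I_u) : x != y -> zspan (pair_unit [set x; y]%SET).
Proof.
move=> xy; have /eqP/cards2P[b [c [bc E0]]] := pr_card (lshift p ord0).
have P0 : zspan (pair_unit [set c; b]%SET).
  suff -> : pair_unit [set c; b]%SET = 0 by exact: zspan0.
  rewrite /pair_unit finset.setUC -E0 (_ : \row_j _ = 0) ?row_mx0//.
  by apply/rowP => j; rewrite !mxE (inj_eq pr_inj) eq_rlshift.
have step i j a : i != a -> j != a -> zspan (pair_unit [set j; a]%SET) -> zspan (pair_unit [set i; a]%SET).
  move=> ia ja Pj; have [->//|ij] := eqVneq i j.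
  by have := zspanD (zspan_pair_diff ij ia ja) Pj; rewrite subrK.
have Pb z : z != b -> zspan (pair_unit [set z; b]%SET).
  by move=> zb; apply: (step _ c) => //; rewrite eq_sym.
have [yb|yb] := eqVneq y b; first by rewrite yb; apply: Pb; rewrite -yb.
by apply: (step _ b) => //; rewrite 1?eq_sym// finset.setUC; exact: Pb.
Qed.

Lemma zspan_row_mx0 (g : 'rV[int]_p) : zspan (row_mx 0 g).
Proof.
have -> : row_mx 0 g = \sum_j g 0 j *: pair_unit (pr (rshift 1 j)).
  apply/rowP => x; rewrite summxE -[x]splitK; case: (fintype.split x) => [l|e] /=.
    by rewrite row_mxEl mxE big1// => j _; rewrite mxE row_mxEl !mxE mulr0.
  rewrite row_mxEr (bigD1 e)//= mxE row_mxEr mxE eqxx mulr1 big1 ?addr0// => j je.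
  by rewrite mxE row_mxEr mxE (inj_eq pr_inj) (inj_eq (@rshift_inj 1 p)) eq_sym (negPf je) mulr0.
elim/big_ind: _ => [|g1 g2 s1 s2|j _]; first exact: zspan0.
  exact: zspanD.
have /eqP/cards2P[l [l' [ll' El]]] := pr_card (rshift 1 j).
by rewrite El -[_ *: _]addr0; apply: zspanP (zspan_pair ll') zspan0.
Qed.

(** Replacing [ord0] by [a] in a block changes the point coordinates by exactly the unit vector at
    [a]; the change of the pair coordinates is already in the span. *)
Lemma zspan_point (a : 'I_u) : zspan (delta_mx 0 (lshift p a)).
Proof.
pose F : {set 'I_u.+1} := [set ord0; emb a]%SET.
have F2 : (#|F| <= 2)%N by apply: (leq_trans (leq_card_setU _ _)); rewrite !cards1.
have [|A AF Ak] := @ex_subset_card _ (~: F) (k - 1).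
  have := cardsC F; rewrite card_ord; lia.
have nA x : x \in F -> x \in A = false.
  by move=> xF; apply/negP => /(fintype.subsetP AF); rewrite inE xF.
have A0 : ord0 \in A = false by apply: nA; rewrite !inE eqxx.
have Aa : emb a \in A = false by apply: nA; rewrite !inE eqxx orbT.
have mk x : x \in A = false -> exists S : block u k, val S = x |: A.
  by move=> xA; apply: block_of; rewrite cardsU1 xA Ak; lia.
have [S ES] := mk _ Aa; have [T ET] := mk _ A0.
suff -> : delta_mx 0 (lshift p a) = (vec S - vec T) - row_mx 0 (rsubmx (vec S - vec T)).
  by apply: zspanB; [exact: zspan_diff|exact: zspan_row_mx0].
apply/rowP => x; rewrite -[x]splitK; case: (fintype.split x) => [l|e] /=.
  rewrite !subE row_mxEl !vec_lshift ES ET !inE emb_neq0 (inj_eq (@emb_inj u)) !mxE.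
  rewrite eqxx /= (inj_eq (@lshift_inj u p)) subr0.
  by have [->|la] := eqVneq l a; rewrite ?Aa//= subrr.
by rewrite !subE row_mxEr [rsubmx _ _ _]mxE !subE subrr mxE eqxx eq_rlshift.
Qed.

Lemma coord_spanning : spanning (coord (k := k) pr).
Proof.
move=> x; have [c [c0 cE]] : zspan (delta_mx 0 x).
  rewrite -[x]splitK; case: (fintype.split x) => [a|e] /=; first exact: zspan_point.
  have -> : delta_mx 0 (rshift u e) = row_mx 0 (delta_mx 0 e) :> 'rV[int]_(u + p).
    apply/rowP => y; rewrite -[y]splitK; case: (fintype.split y) => [l|f] /=.
      by rewrite row_mxEl !mxE eqxx eq_lrshift.
    by rewrite row_mxEr !mxE (inj_eq (@rshift_inj u p)).
  exact: zspan_row_mx0.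
exists c; split=> // y; move/rowP: cE => /(_ y); rewrite summxE !mxE eqxx /= eq_sym natz => ->.
by apply: eq_bigr => S _; rewrite !mxE.
Qed.

End Spanning.

(** * Incidence matrices as walks *)

Section IncidenceMatrices.
Variables (u k p : nat) (pr : 'I_(1 + p) -> {set 'I_u}).
Hypotheses (pr_inj : injective pr) (pr_card : forall e, #|pr e| = 2%N).
Hypothesis pr_surj : forall s : {set 'I_u}, #|s| = 2%N -> exists e, pr e = s.
Hypotheses (k2 : (2 <= k)%N) (ku : (k < u)%N).
Variable t : nat.
Implicit Type f : {ffun 'I_t -> block u k}.

Definition blocks_mx f : 'M[bool]_(u.+1, t) := \matrix_(i, j) (i \in val (f j)).

Lemma blocks_mx_inj : injective blocks_mx.
Proof.
move=> f g /matrixP fg; apply/ffunP => j; apply: val_inj; apply/setP => i.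
by have := fg i j; rewrite !mxE.
Qed.

Lemma column_ones_blocks f j : column_ones (blocks_mx f) j = k.
Proof.
rewrite -[RHS](eqP (valP (f j))); apply: eq_card => i.
by rewrite !inE mxE.
Qed.

Lemma blocks_mx_surj (M : 'M[bool]_(u.+1, t)) :
  (forall j, column_ones M j = k) -> exists f, M = blocks_mx f.
Proof.
move=> Mk.
have bk j : #|[set i | M i j]%SET| == k by rewrite cardsE -(Mk j).
exists [ffun j => exist _ [set i | M i j]%SET (bk j) : block u k].
by apply/matrixP => i j; rewrite !mxE ffunE /= inE.
Qed.

Lemma row_innerC f a b : row_inner (blocks_mx f) a b = row_inner (blocks_mx f) b a.
Proof. by apply: eq_bigr => j _; rewrite mulnC. Qed.

Lemma row_inner_diag f a : row_inner (blocks_mx f) a a = (\sum_(j < t) (a \in val (f j)))%N.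
Proof. by apply: eq_bigr => j _; rewrite !mxE mulnb andbb. Qed.

Lemma card_blockE f j : (\sum_a (a \in val (f j)))%N = k.
Proof.
rewrite -[RHS](eqP (valP (f j))) -sum1_card [RHS]big_mkcond /=.
by apply: eq_bigr => a _; case: (a \in _).
Qed.

Lemma sum_row_inner f a :
  (\sum_b row_inner (blocks_mx f) a b = k * row_inner (blocks_mx f) a a)%N.
Proof.
rewrite row_inner_diag exchange_big big_distrr /=; apply: eq_bigr => j _.
transitivity ((\sum_b (b \in val (f j))) * (a \in val (f j)))%N; last by rewrite card_blockE.
by rewrite big_distrl /=; apply: eq_bigr => b _; rewrite !mxE mulnC.
Qed.

Lemma sum_row_inner_diag f : (\sum_a row_inner (blocks_mx f) a a = k * t)%N.
Proof.
under eq_bigr do rewrite row_inner_diag.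
rewrite exchange_big /=; under eq_bigr do rewrite card_blockE.
by rewrite sum_nat_const card_ord mulnC.
Qed.

Variables r l : nat.
Hypotheses (rE : (r * u.+1 = t * k)%N) (lE : (l * (u.+1 * u) = t * (k * k.-1))%N).

Lemma replication : (k.-1 * r = u * l)%N.
Proof.
apply/eqP; rewrite -(eqn_pmul2r (ltn0Sn u)) -mulnA rE; apply/eqP.
by rewrite mulnAC [RHS]mulnC [(u * u.+1)%N]mulnC lE; ring.
Qed.

Local Notation D f a b := ((row_inner (blocks_mx f) a b)%:R : rat).

Let kr : k.-1%:R = k%:R - 1 :> rat.
Proof. by rewrite -[in RHS](prednK (ltnW k2)) -natr1 addrK. Qed.

Let kr0 : (k%:R - 1 : rat) != 0.
Proof. by rewrite -kr pnatr_eq0; lia. Qed.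

Let ur0 : (u%:R : rat) != 0.
Proof. by rewrite pnatr_eq0; lia. Qed.

Let replR : (k%:R - 1) * r%:R = u%:R * l%:R :> rat.
Proof. by rewrite -kr -!natrM replication. Qed.

Let rER : r%:R * (1 + u%:R) = t%:R * k%:R :> rat.
Proof. by rewrite -(natrD _ 1%N) add1n -!natrM rE. Qed.

Let sum_rowR f a : \sum_b D f a b = k%:R * D f a a.
Proof. by rewrite -natr_sum sum_row_inner natrM. Qed.

Let sum_diagR f : \sum_a D f a a = k%:R * t%:R.
Proof. by rewrite -natr_sum sum_row_inner_diag natrM. Qed.

(** Counting incidences in the blocks through [a] gives [u * l' = (k - 1) * r_a], with [r_a] the
    replication number of [a]. Summing over [a] identifies [l'], and the equation then returns each
    [r_a]. *)
Lemma BIBD_parameters f (l' : nat) :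
  (forall a b, a <> b -> row_inner (blocks_mx f) a b = l') ->
  l' = l /\ forall a, row_inner (blocks_mx f) a a = r.
Proof.
move=> H.
have diag a : u%:R * l'%:R = (k%:R - 1) * D f a a.
  have := sum_rowR f a; rewrite (bigD1 a)//= (eq_bigr (fun=> l'%:R)); last first.
    by move=> b ba; rewrite H// => ab; move: ba; rewrite ab eqxx.
  rewrite sumr_const cardC1 card_ord /= -mulr_natl; lra.
have ll : l'%:R = l%:R :> rat.
  have : \sum_(a < u.+1) (u%:R * l'%:R) = \sum_(a < u.+1) ((k%:R - 1) * D f a a) :> rat.
    by apply: eq_bigr => a _; exact: diag.
  have -> : \sum_(a < u.+1) (u%:R * l'%:R) = (u%:R + 1) * (u%:R * l'%:R) :> rat.
    by rewrite sumr_const card_ord -[LHS]mulr_natl natr1.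
  rewrite -mulr_sumr sum_diagR => h.
  have h2 : (k%:R - 1) * (k%:R * t%:R) = (1 + u%:R) * (u%:R * l%:R) :> rat.
    by rewrite -replR -(mulrC t%:R) -rER; ring.
  have v0 : (u%:R + 1 : rat) != 0 by rewrite natr1 pnatr_eq0.
  by apply: (mulfI ur0); apply: (mulfI v0); rewrite h h2; ring.
split; first by apply/eqP; rewrite -(eqr_nat rat) ll.
move=> a; apply/eqP; rewrite -(eqr_nat rat); apply/eqP/(mulfI kr0).
by rewrite -diag ll replR.
Qed.

(** The walk coordinates leave unknown the replication of [ord0], the pairs through [ord0] and the
    omitted pair. The total number of incidences gives the first, and the row sums determine the
    rest. *)
Lemma BIBD_of_coord f :
  (forall a : 'I_u, row_inner (blocks_mx f) (emb a) (emb a) = r) ->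
  (forall (e : 'I_p) a b, pr (rshift 1 e) = [set a; b]%SET ->
     row_inner (blocks_mx f) (emb a) (emb b) = l) ->
  forall a b, a <> b -> row_inner (blocks_mx f) a b = l.
Proof.
move=> Hr Hl.
have D00 : D f ord0 ord0 = r%:R.
  have := sum_diagR f; rewrite big_ord_recl /= (eq_bigr (fun=> r%:R)); last first.
    by move=> a _; rewrite Hr.
  rewrite sumr_const card_ord -mulr_natl; have := rER; lra.
have row (a : 'I_u) : D f ord0 (emb a) + \sum_(b < u) D f (emb a) (emb b) = k%:R * r%:R.
  by rewrite row_innerC -(Hr a) -sum_rowR big_ord_recl.
have row0 : \sum_(a < u) D f ord0 (emb a) = k%:R * r%:R - r%:R.
  by have := sum_rowR f ord0; rewrite D00 big_ord_recl /= D00; lra.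
have /eqP/cards2P[b0 [c0 [bc E0]]] := pr_card (lshift p ord0).
set y := D f (emb b0) (emb c0).
(* The required entries plus the unknown defect [y - l] at the omitted pair, in a form that can be
   summed. *)
have entry (a b : 'I_u) : D f (emb a) (emb b) = l%:R + (a == b)%:R * (r%:R - l%:R) +
    ((a == b0)%:R * (b == c0)%:R + (a == c0)%:R * (b == b0)%:R) * (y - l%:R).
  have [<-|ab] := eqVneq a b.
    have zz : (a == b0)%:R * (a == c0)%:R + (a == c0)%:R * (a == b0)%:R = 0 :> rat.
      have [->|_] := eqVneq a b0; first by rewrite (negPf bc) mul0r mulr0 addr0.
      by rewrite mul0r mulr0 addr0.
    by rewrite Hr zz mul1r mul0r addr0 addrC subrK.
  have [|e Ee] := @pr_surj [set a; b]%SET; first by rewrite cards2 ab.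
  have [e0|e0] := eqVneq e (lshift p ord0).
    move: Ee; rewrite e0 E0 => /esym/eqP; rewrite eq_set2// => /orP[] /andP[/eqP -> /eqP ->].
      by rewrite !eqxx [c0 == b0]eq_sym (negPf bc) -[true%:R]/(1 : rat) -[false%:R]/(0 : rat); ring.
    rewrite !eqxx [c0 == b0]eq_sym (negPf bc) -[true%:R]/(1 : rat) -[false%:R]/(0 : rat).
    by rewrite row_innerC -/y; ring.
  have [j ej] : exists j, e = rshift 1 j.
    rewrite -[e]splitK in e0 *; case: (fintype.split e) e0 => [i|j _]; last by exists j.
    by rewrite ord1 eqxx.
  have := Hl j a b; rewrite -ej Ee => -> //.
  have : [set a; b]%SET != [set b0; c0]%SET by rewrite -Ee -E0 (inj_eq pr_inj).
  rewrite eq_set2//.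
  by case: (a == b0); case: (b == c0); case: (a == c0); case: (b == b0) => //= _; rewrite ?mul0r ?mulr0 ?mul0r ?addr0 ?mul0r ?addr0.
have pick1 (x : 'I_u) : \sum_(a < u) (a == x)%:R = 1 :> rat.
  by rewrite (bigD1 x)//= eqxx big1 ?addr0// => a /negPf ->.
have inner (a : 'I_u) : \sum_(b < u) D f (emb a) (emb b) = u%:R * l%:R + (r%:R - l%:R) +
    ((a == b0)%:R + (a == c0)%:R) * (y - l%:R).
  under eq_bigr do rewrite entry.
  rewrite !big_split /= sumr_const card_ord -mulr_natl -mulr_suml -mulr_suml big_split /= -!mulr_sumr !pick1.
  by rewrite (eq_bigr (fun b : 'I_u => (b == a)%:R)) ?pick1; [ring|move=> b _; rewrite eq_sym].
(* Adding the row equations of all points but [ord0] and inserting the row sum of [ord0] leaves one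
   linear equation, whose only unknown is [y]. *)
have yl : y = l%:R.
  have : \sum_(a < u) (D f ord0 (emb a) + \sum_(b < u) D f (emb a) (emb b)) = \sum_(a < u) (k%:R * r%:R).
    by apply: eq_bigr => a _; exact: row.
  rewrite big_split /= row0; under eq_bigr do rewrite inner.
  have -> : \sum_(a < u) (k%:R * r%:R) = u%:R * (k%:R * r%:R) :> rat.
    by rewrite sumr_const card_ord -[LHS]mulr_natl.
  rewrite big_split /= sumr_const card_ord -mulr_suml big_split /= !pick1.
  rewrite -(mulr_natl _ u) => h.
  have := congr1 (fun z => (u%:R - 1) * z) replR => /= h2.
  lra.
have inner' (a : 'I_u) : D f ord0 (emb a) = l%:R.
  by have := row a; rewrite inner yl subrr mulr0; have := replR; lra.
have fin (a b : 'I_u.+1) : a != b -> D f a b = l%:R.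
  have cases (x : 'I_u.+1) : x = ord0 \/ exists a', x = emb a'.
    by case: (unliftP ord0 x) => [a' ->|->]; [right; exists a'|left].
  case: (cases a) (cases b) => [->|[a' ->]] [->|[b' ->]] ab.
  - by rewrite eqxx in ab.
  - exact: inner'.
  - by rewrite row_innerC.
  - rewrite (inj_eq (@emb_inj u)) in ab.
    by rewrite entry (negPf ab) yl subrr mulr0 mul0r !addr0.
by move=> a b /eqP ab; apply/eqP; rewrite -(eqr_nat rat) fin.
Qed.

Definition target (x : 'I_(u + p)) : nat := if fintype.split x is inl _ then r else l.

Lemma coord_sum_lshift f a :
  (\sum_(j < t) coord pr (f j) (lshift p a) = row_inner (blocks_mx f) (emb a) (emb a))%N.
Proof. by rewrite row_inner_diag; apply: eq_bigr => j _; rewrite /coord supp_lshift finset.sub1set. Qed.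

Lemma coord_sum_rshift f e a b : pr (rshift 1 e) = [set a; b]%SET ->
  (\sum_(j < t) coord pr (f j) (rshift u e) = row_inner (blocks_mx f) (emb a) (emb b))%N.
Proof.
move=> E; apply: eq_bigr => j _; rewrite !mxE mulnb /coord supp_rshift E.
by rewrite imsetU !imset_set1 finset.subUset !finset.sub1set.
Qed.

(** Matrices with column sums [k] correspond to walks, and the design condition to the end point
    [target]. The positivity of [l] supplies that of the pair count demanded of a design. *)
Lemma Psi_walk_count : (0 < l)%N -> Psi u.+1 k t = walk_count (coord (k := k) pr) t target.
Proof.
move=> l0; rewrite /Psi /walk_count -(fintype.card_image blocks_mx_inj); apply: eq_card => M.
rewrite !inE; apply/asboolP/fintype.imageP => [[[k' [l' [_ _ _ Ml]]] Mk]|[f + ->]].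
  have [f Mf] := blocks_mx_surj Mk; exists f => //; rewrite inE.
  rewrite Mf in Ml; have [ll diag] := BIBD_parameters Ml.
  apply/forallP => x; rewrite -[x]splitK; case: (fintype.split x) => [a|e] /=.
    by rewrite coord_sum_lshift diag /target (unsplitK (inl a)).
  rewrite /target (unsplitK (inr e)).
  have /eqP/cards2P[a [b [ab E]]] := pr_card (rshift 1 e).
  rewrite (coord_sum_rshift f E) Ml ?ll// => /emb_inj; exact/eqP.
rewrite inE => /forallP H; split; last by move=> j; exact: column_ones_blocks.
exists k, l; split=> //; first exact: ltnW.
  by move=> j; exact: column_ones_blocks.
apply: BIBD_of_coord => [a|e a b E].
  by have := H (lshift p a); rewrite coord_sum_lshift /target (unsplitK (inl a)) => /eqP.
by have := H (rshift u e); rewrite (coord_sum_rshift f E) /target (unsplitK (inr e)) => /eqP.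
Qed.

End IncidenceMatrices.

(** * Admissible parameters and the asymptotic formula *)

Lemma admissible_params (v k t : nat) : (1 < v)%N -> (1 < k)%N -> admissible v k t ->
  [/\ (0 < t)%N, exists r, (r * v = t * k)%N & exists2 l, (0 < l)%N & (l * (v * v.-1) = t * (k * k.-1))%N].
Proof.
move=> v1 k1 [t0 h1 h2].
have pred_natr (n : nat) : (1 < n)%N -> n%:R - 1 = n.-1%:R :> rat.
  by move=> n1; rewrite -[in LHS](prednK (ltnW n1)) -natr1 addrK.
have v0 : (v%:R : rat) != 0 by rewrite pnatr_eq0; lia.
have v10 : (v.-1%:R : rat) != 0 by rewrite pnatr_eq0; lia.
split=> //.
  have : (t%:R * (k%:R / v%:R) : rat) \is a Num.nat by rewrite natrEint h1 mulr_ge0// divr_ge0.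
  move=> /natrP[r rE]; exists r; apply/eqP; rewrite -(eqr_nat rat) !natrM -rE.
  by apply/eqP; field.
rewrite !pred_natr// in h2.
have : (t%:R * ((k%:R * k.-1%:R) / (v%:R * v.-1%:R)) : rat) \is a Num.nat.
  by rewrite natrEint h2 mulr_ge0// divr_ge0// mulr_ge0.
move=> /natrP[l lE].
have lE' : (l * (v * v.-1) = t * (k * k.-1))%N.
  apply/eqP; rewrite -(eqr_nat rat) !natrM -lE; apply/eqP; field; by rewrite v0 v10.
exists l => //; rewrite lt0n; apply/eqP => l0; move: lE'; rewrite l0 mul0n => /esym/eqP.
by rewrite !muln_eq0; lia.
Qed.

Lemma ex_pair_enum (u : nat) : (2 <= u)%N -> exists p (pr : 'I_(1 + p) -> {set 'I_u}),
  [/\ injective pr, forall e, #|pr e| = 2%N &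
      forall s : {set 'I_u}, #|s| = 2%N -> exists e, pr e = s].
Proof.
move=> u2; pose A := [set s : {set 'I_u} | #|s| == 2%N]%SET.
have cA : #|A| = (1 + 'C(u, 2).-1)%N by rewrite card_draws card_ord add1n prednK// bin_gt0.
exists 'C(u, 2).-1, (fun e => enum_val (cast_ord (esym cA) e)); split.
- by move=> e f /enum_val_inj /cast_ord_inj.
- by move=> e; have := enum_valP (cast_ord (esym cA) e); rewrite inE => /eqP.
- move=> s s2; have sA : s \in A by rewrite inE s2.
  by exists (cast_ord cA (enum_rank_in sA s)); rewrite cast_ordK enum_rankK_in.
Qed.

Local Open Scope classical_set_scope.

Theorem theoremA (R : realType) (v k : nat)
    (hk : (2 <= k)%N) (hvk : (2 <= v - k)%N) :
  exists e : nat -> R,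
    e t @[t --> within (admissible v k) \oo] --> (0 : R) /\
    forall t : nat, admissible v k t ->
      (Psi v k t)%:R =
      (1 + e t) *
        ('C(v, k)%:R ^+ t /
         Num.sqrt ((2 * pi * t%:R) ^+ ('C(v, 2) - 1) * bibd_f R v k)).
Proof.
have v0 : (0 < v)%N by lia.
rewrite -(prednK v0) in hvk *; move: (v.-1) hvk => u hvk {v0}.
have ku : (k < u)%N by lia.
have [p [pr [pr_inj pr_card pr_surj]]] : exists p (pr : 'I_(1 + p) -> {set 'I_u}),
    [/\ injective pr, forall e, #|pr e| = 2%N &
      forall s : {set 'I_u}, #|s| = 2%N -> exists e, pr e = s].
  by apply: ex_pair_enum; lia.
have detE := det_covmx_bibd R pr_inj pr_card pr_surj hk ku.
have dimE : ('C(u.+1, 2) - 1 = u + p)%N.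
  by rewrite binS bin1 (bin_pairs R pr_inj pr_card pr_surj hk ku); lia.
have K0 := card_block_gt0 ku.
have sp := coord_spanning pr_inj pr_card hk ku.
have u_gt0 : (1 < u.+1)%N by lia.
have params t (ht : admissible u.+1 k t) := admissible_params u_gt0 hk ht.
(* The target end point must be a function of every [t]; outside the admissible ones it is set to
   0. *)
have /choice[m mP] (t : nat) : exists mt : 'I_(u + p) -> nat, admissible u.+1 k t ->
    Psi u.+1 k t = walk_count (coord (k := k) pr) t mt /\
    forall x, (mt x)%:R = t%:R * mean R (coord (k := k) pr) x.
  have [ht|ht] := pselect (admissible u.+1 k t); last by exists (fun=> 0%N) => /ht.
  have [t0 [r rE] [l l0 lE]] := params t ht.
  exists (@target u p r l) => _; split.
    exact: Psi_walk_count.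
  move=> x; rewrite mean_coord// /target /supp /incl_prob.
  have u0 : u.+1%:R != 0 :> R by rewrite pnatr_eq0.
  have u1 : u%:R != 0 :> R by rewrite pnatr_eq0; lia.
  case: (fintype.split x) => [i|e].
    rewrite cards1 !ffactn1.
    have : (r * u.+1)%:R = (t * k)%:R :> R by rewrite rE.
    by rewrite !natrM => h; rewrite mulrA -h mulfK.
  rewrite card_imset ?pr_card; last exact: emb_inj.
  have ff n : (n ^_ 2 = n * n.-1)%N by rewrite ffactnS ffactn1.
  have : (l * (u.+1 * u))%:R = (t * (k * k.-1))%:R :> R by rewrite lE.
  rewrite !ff /= !natrM => h; rewrite mulrA -h mulfK// mulf_neq0//.
have lim := local_limit K0 sp (P := admissible u.+1 k) (fun t ht => (mP t ht).2).
have cK : #|block u k| = 'C(u.+1, k) := card_block u k.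
rewrite cK detE in lim; rewrite dimE; set F := bibd_f R u.+1 k in lim *.
(* Positivity comes from the positive definite covariance rather than from the formula. *)
have F0 : 0 < F.
  by rewrite /F -detE; have [] := gauss_sum_cvg (covmx_posdef R K0 sp).
(* With [rho - 1] as the error term the formula is an identity at each admissible [t], and the local
   limit theorem gives its convergence to 0. *)
pose rho t : R := (Psi u.+1 k t)%:R / 'C(u.+1, k)%:R ^+ t * Num.sqrt ((2 * pi * t%:R) ^+ (u + p) * F).
exists (fun t => rho t - 1); split.
  rewrite -(subrr 1); apply: cvgB; last exact: cvg_cst.
  apply: cvg_trans lim; apply: near_eq_cvg; rewrite near_withinE.
  by apply: nearW => t ht; rewrite /rho (mP t ht).1.
move=> t ht; have [t0 _ _] := params t ht.
have s0 : Num.sqrt ((2 * pi * t%:R) ^+ (u + p) * F) != 0.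
  by rewrite gt_eqF// sqrtr_gt0 mulr_gt0// exprn_gt0// !mulr_gt0 ?pi_gt0// ltr0n.
have C0 : 'C(u.+1, k)%:R ^+ t != 0 :> R by rewrite expf_neq0// pnatr_eq0 -cK -lt0n.
by rewrite addrC subrK /rho; field; rewrite C0 s0.
Qed.
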